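(* Let $\{M_n, n\ge 1\}$ be a sequence of real-valued random variables and let $\{W(t), t\ge 0\}$ be a standard Brownian motion defined on the same probability space. Let $\{a_n, n\ge 1\}$ and $\{b_n, n\ge 1\}$ be (deterministic) positive sequences such that $b_n\uparrow\infty$, $b_{n+1}/b_n\to 1$, and $$\frac{M_n}{a_n}-W(b_n)=o\left(\sqrt{b_n\log\log b_n}\right)\quad\text{almost surely as } n\to\infty.$$ If $a_n$ and $b_n$ vary regularly with indices $\rho_1>-1$ and $\rho_2\ge 0$, respectively, then $$\limsup_{n\to\infty}\frac{1}{\sqrt{2a_n^2 b_n\log\log b_n}}\left|\frac1n\sum_{k=1}^n M_k\right|=\sqrt{2}\,\big((1+\rho_1+\rho_2)(2+2\rho_1+\rho_2)\big)^{-1/2}\quad\text{almost surely.}$$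
   Context: A positive sequence $\{c_n, n\ge1\}$ varies regularly with index $\rho\in\mathbb{R}$ if $c_{[\lambda n]}/c_n\to\lambda^{\rho}$ as $n\to\infty$ for every $\lambda>0$, where $[x]$ is the integer part of $x$. Expressions involving $\log\log b_n$ are considered for $n$ large enough that they are defined and positive. *)

(* Defs.v *)
From HB Require Import structures.
From mathcomp Require Import all_boot all_order all_algebra.
From mathcomp Require Import all_classical all_reals all_analysis.
From mathcomp Require Import measurable_realfun.
Set Implicit Arguments.
Unset Strict Implicit.
Unset Printing Implicit Defensive.
Import Order.TTheory GRing.Theory Num.Theory.
Import numFieldNormedType.Exports.
Local Open Scope classical_set_scope.
Local Open Scope ring_scope.

(* Sequences {c_n, n >= 1} are functions on nat whose value at 0 is
   irrelevant. *)
Definition positive_seq (R : realType) (c : nat -> R) : Prop :=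
  forall n, (0 < n)%N -> 0 < c n.

Definition regularly_varying (R : realType) (c : nat -> R) (rho : R) : Prop :=
  positive_seq c /\
  forall lambda : R, 0 < lambda ->
    c (Num.truncn (lambda * n%:R)) / c n @[n --> \oo] --> lambda `^ rho.

(* Taking some of the [B i] equal to [setT] gives the product rule for every
   subfamily. *)
Definition mutually_independent (d : measure_display) (T : measurableType d)
    (R : realType) (P : probability T R) (I : finType)
    (X : I -> {RV P >-> R}) : Prop :=
  forall B : I -> set R, (forall i, measurable (B i )) ->
    P (\bigcap_(i in [set: I]) (X i @^-1` B i)) =
    (\prod_(i : I) P (X i @^-1` B i))%E.

(* The process is indexed by [0, +oo[ : only [W t] with [0 <= t] matters. *)
Definition standard_brownian_motion (d : measure_display)
    (T : measurableType d) (R : realType) (P : probability T R)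
    (W : R -> {RV P >-> R}) : Prop :=
  [/\ {ae P, forall w, W 0 w = 0},
      forall (n : nat) (t : nat -> R), 0 <= t 0%N ->
        {homo t : i j / (i <= j)%N >-> i <= j} ->
        mutually_independent
          (fun i : 'I_n => (W (t i.+1) - W (t i) : {RV P >-> R})),
      (* the second argument of [normal_prob] is the standard deviation *)
      forall s t : R, 0 <= s -> s < t ->
        forall A, measurable A ->
        distribution P (W t - W s : {RV P >-> R}) A =
        normal_prob 0 (Num.sqrt (t - s)) A
    & {ae P, forall w, {within `[0, +oo[, continuous (fun t => W t w)}}].

(* Main.v *)
Require Import Defs.
From HB Require Import structures.
From mathcomp Require Import all_boot all_order all_algebra.
From mathcomp Require Import all_classical all_reals all_analysis.
From mathcomp Require Import measurable_realfun.
From mathcomp Require Import ring lra zify.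
Import Order.TTheory GRing.Theory Num.Theory.
Import numFieldNormedType.Exports.
Local Open Scope classical_set_scope.
Local Open Scope ring_scope.
Set Implicit Arguments.
Unset Strict Implicit.
Unset Printing Implicit Defensive.

(** Divided by [n * a n], the sum of the [M k] is the mean of the [M k / a k] with
   the weights [a k / (n * a n)], and [M k / a k] may be replaced by [W (b k)]. As
   [k] runs over [1 .. n], regular variation says that the weights approach the
   density [x ^ rho1] at [x = k / n] (Karamata's theorem) and that [b k] is close
   to [x ^ rho2 * b n]. So the mean is close to the integral over [0, 1] of
   [x ^ rho1 * W (x ^ rho2 * t)] at [t = b n]. This is a linear functional of the
   path with the scaling of Brownian motion, and the law of the iterated logarithm
   holds for it with the standard deviation of its value at [t = 1], whose square
   is [2 / ((1 + rho1 + rho2) * (2 + 2 * rho1 + rho2))].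

   The integral is replaced by finite sums over the partitions of [0, 1] by the
   powers of a ratio [r < 1] (the step functionals). Almost every path has a
   modulus of continuity of the order of [sqrt (t * ln (ln t))]
   ([brownian_loglog_modulus], by dyadic chaining), so that, for [r] close to one
   and enough points, the mean and the step functional at [b n] differ by a small
   multiple of this normalization ([scaled_mean_step_functional]). The same modulus
   fills the gaps between the geometric times [c ^+ j], and between these times and
   the values of [b], whose consecutive ratios tend to one; this makes slowly
   varying [b], that is [rho2 = 0], no different from the others.

   For a finite combination of increments, the law of the iterated logarithm only
   needs one-dimensional Gaussian tails and the product rule on rectangles. From
   above, a weighted sum can only be large if the vector of normalized increments
   leaves a ball, by the Cauchy-Schwarz inequality, and the complement of a ball is
   covered by finitely many rectangles with the right exponential rate
   ([gaussian_ball_prob], [inc_sum_limsup_le]). From below, the rectangle prescribed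
   by the equality case of that inequality has the same rate, and over disjoint
   blocks of time these rectangles are independent events
   ([inc_sum_limsup_ge]). *)

(** * Auxiliary facts on limits and finite operations *)

Lemma cvg_near_eq {R : realType} (f g : nat -> R) (l l' : R) :
  g n @[n --> \oo] --> l -> l = l' -> (\forall n \near \oo, g n = f n) ->
  f n @[n --> \oo] --> l'.
Proof.
move=> gl <- gf; apply: cvg_trans gl; apply: near_eq_cvg.
by apply: filterS gf => n.
Qed.

Lemma near_forall_leq (Q : nat -> nat -> Prop) (I : nat) :
  (forall i, (i <= I)%N -> \forall n \near \oo, Q i n) ->
  \forall n \near \oo, forall i, (i <= I)%N -> Q i n.
Proof.
elim: I => [|I IH] H.
  by have := H 0%N isT; apply: filterS => n Qn i; rewrite leqn0 => /eqP ->.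
have := H I.+1 (leqnn _); have := IH (fun i iI => H i (leqW iI)).
apply: filterS2 => n QI QS i; rewrite leq_eqVlt => /orP[/eqP ->//|]; exact: QI.
Qed.

Lemma limn_esup_EFin {R : realType} (u : nat -> R) (l : R) :
  (forall e, 0 < e -> \forall n \near \oo, u n <= l + e) ->
  (forall e, 0 < e -> forall N, exists2 n, (N <= n)%N & l - e <= u n) ->
  limn_esup (fun n => (u n)%:E) = l%:E.
Proof.
move=> Hle Hge; rewrite limn_esup_lim; apply/eqP; rewrite eq_le; apply/andP; split.
  apply/lee_addgt0Pr => e e0; have [N _ HN] := Hle e e0.
  apply: lime_le; first exact: is_cvg_esups.
  exists N => // n /= Nn; apply: ge_ereal_sup => _ [k /= nk <-].
  by rewrite -EFinD lee_fin; apply: HN; exact: leq_trans nk.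
apply/lee_addgt0Pr => e e0; rewrite -leeBlDr//.
apply: lime_ge; first exact: is_cvg_esups.
apply: nearW => n; have [k nk lk] := Hge e e0 n.
apply: (@le_trans _ _ (u k)%:E); first by rewrite -EFinB lee_fin.
by apply: ereal_sup_ubound; exists k.
Qed.

(** * Borel-Cantelli lemmas *)

Section probability.
Context {R : realType} {d : measure_display} {T : measurableType d}.
Variable P : probability T R.

(** First Borel-Cantelli lemma. Bounds that come from iterated logarithms only
   hold eventually, hence the form of the last hypothesis. *)
Lemma eventually_notin (F : nat -> set T) (u : nat -> R) (B : R) :
  (forall n, measurable (F n)) -> (forall n, 0 <= u n) ->
  (forall n, \sum_(0 <= k < n) u k <= B) ->
  (\forall n \near \oo, (P (F n) <= (u n)%:E)%E) ->
  {ae P, forall w, \forall n \near \oo, ~ F n w}.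
Proof.
move=> mF u0 uB [N _ HN].
pose G k := F (k + N)%N.
have mG k : measurable (G k) by exact: mF.
have GB : (\sum_(n <oo) P (G n) < +oo)%E.
  apply: (@le_lt_trans _ _ B%:E); last exact: ltry.
  apply: lime_le; first by apply: is_cvg_nneseries => *; exact: measure_ge0.
  apply: nearW => n.
  apply: (@le_trans _ _ (\sum_(0 <= k < n) (u (k + N)%N)%:E)%E).
    by apply: lee_sum => i _; apply: HN; rewrite /= leq_addl.
  rewrite sumEFin lee_fin; apply: le_trans (uB (n + N)%N).
  rewrite [leRHS](big_cat_nat (n:=N))//= ?leq_addl//.
  by rewrite -{3}[N]add0n big_addn addnK lerDr sumr_ge0.
exists (lim_sup_set G); split.
- apply: bigcap_measurable => // n _.
  by apply: bigcup_measurable => j /= _; exact: mG.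
- exact: lim_sup_set_cvg0.
move=> w /= nw n _; apply: contrapT => nG.
apply: nw; exists (n + N)%N => //= k nk Fk; apply: nG; exists (k - N)%N => /=.
  by rewrite leq_subRL ?(leq_trans _ nk)// ?leq_addl// addnC.
by rewrite /G subnK// (leq_trans _ nk)// leq_addl.
Qed.

(** Adding the event [~` A j] to an intersection amounts to a difference of two
   intersections, which turns the product rule for the events [A j] into one
   that also allows their complements. *)
Lemma setC_product_rule (A : nat -> set T) (p : nat -> R) :
  (forall n, measurable (A n)) ->
  (forall s, uniq s ->
     P (\big[setI/setT]_(j <- s) A j) = (\prod_(j <- s) p j)%:E) ->
  forall s' s, uniq (s' ++ s) ->
     P (\big[setI/setT]_(j <- s') ~` A j `&` \big[setI/setT]_(j <- s) A j) =
     (\prod_(j <- s') (1 - p j) * \prod_(j <- s) p j)%:E.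
Proof.
move=> mA HA; elim=> [|j s' IH] s /= us.
  by rewrite !big_nil setTI mul1r HA.
have mI B u : (forall n, measurable (B n)) ->
    measurable (\big[setI/setT]_(k <- u) B k : set T).
  by move=> mB; apply: big_ind => //; exact: measurableI.
have mC n : measurable (~` A n) by exact: measurableC.
rewrite !big_cons.
set X := \big[setI/setT]_(k <- s') _; set Y := \big[setI/setT]_(k <- s) _.
have mX : measurable X by exact: mI.
have mY : measurable Y by exact: mI.
have -> : ~` A j `&` X `&` Y = (X `&` Y) `\` A j by rewrite setDE setIC setIA setIC -setIA setIC.
case/andP: us => jn us.
have us2 : uniq (s' ++ j :: s) by rewrite -cat_rcons -cats1 -catA uniq_catCA /= jn us.
rewrite measureD//=; [|exact: measurableI|]; last first.
  by rewrite (le_lt_trans (probability_le1 _ _)) ?ltry//; exact: measurableI.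
rewrite IH// -setIA (setIC Y).
have -> : A j `&` Y = \big[setI/setT]_(k <- j :: s) A k by rewrite big_cons.
rewrite [X in (_ - X)%E]IH // big_cons -EFinB; congr EFin; ring.
Qed.

(** Second Borel-Cantelli lemma: by the product rule for complements, the
   probability that none of the events of a window occurs is at most the
   exponential of minus the sum of their probabilities. *)
Lemma product_rule_infinitely_often (A : nat -> set T) (p : nat -> R) :
  (forall n, measurable (A n)) ->
  (forall s, uniq s ->
     P (\big[setI/setT]_(j <- s) A j) = (\prod_(j <- s) p j)%:E) ->
  (forall n, p n <= 1) ->
  (forall m B, exists k, B <= \sum_(j <- iota m k) p j) ->
  {ae P, forall w, forall m, exists2 j, (m <= j)%N & A j w}.
Proof.
move=> mA HA p1 pB.
pose C m k := \big[setI/setT]_(j <- iota m k) ~` A j.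
have mC m k : measurable (C m k).
  by apply: big_ind => //; [exact: measurableI|move=> i _; exact: measurableC].
have PC m k : (P (C m k) <= (expR (- \sum_(j <- iota m k) p j))%:E)%E.
  have := @setC_product_rule A p mA HA (iota m k) [::].
  rewrite cats0 big_nil setIT => -> ; last exact: iota_uniq.
  rewrite big_nil mulr1 lee_fin -sumrN expR_sum.
  apply: ler_prod => i _; rewrite subr_ge0 p1/=.
  exact: expR_ge1Dx.
suff neg m : P.-negligible (\bigcap_k C m k).
  apply: (negligibleS (A := \bigcup_m \bigcap_k C m k)).
    move=> w /= /existsNP[m nm]; exists m => // k _; rewrite /C.
    rewrite -bigcap_seq => i /=; rewrite mem_iota => /andP[mi _] Ai.
    by apply: nm; exists i.
  by apply: negligible_bigcup => m; exact: neg.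
have mI : measurable (\bigcap_k C m k) by exact: bigcapT_measurable.
apply/negligibleP => //; apply/eqP; rewrite eq_le measure_ge0 andbT.
apply/lee_addgt0Pr => e e0; rewrite add0e.
have [k Hk] := pB m (- ln e).
apply: (@le_trans _ _ (P (C m k))).
  by apply: le_measure; rewrite ?inE//; apply: bigcap_inf.
apply: (le_trans (PC m k)); rewrite lee_fin -[leRHS]lnK// ler_expR.
by rewrite lerNl.
Qed.
End probability.

(** * Gaussian tails *)

Section gaussian_tails.
Context {R : realType}.
Implicit Types s x y m : R.

Lemma norm_ge_setE (x : R) :
  [set y : R | x <= `|y|] = `[x, +oo[%classic `|` `]-oo, - x]%classic.
Proof.
apply/seteqP; split => y /=; rewrite !in_itv/= ?andbT ler_normr lerNr.
  by case/orP; [left|right].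
by case=> ->; rewrite ?orbT.
Qed.

Lemma measurable_norm_ge (x : R) : measurable [set y : R | x <= `|y|].
Proof. by rewrite norm_ge_setE; exact: measurableU. Qed.

Lemma measurable_ge (x : R) : measurable [set y : R | x <= y].
Proof. by have := measurable_itv `[x, +oo[; rewrite set_itvE. Qed.

(** Change of mean: on a half-line that starts at [m] and points away from the
   origin, the centred density is at most [expR (- x ^+ 2 / 2)] times the density
   centred at [m], whose total mass is one. *)
Lemma normal_prob_shift s x m (D : set R) : measurable D -> 0 < s ->
  m ^+ 2 = (x * s) ^+ 2 -> (forall y, D y -> 0 <= m * (y - m)) ->
  (normal_prob 0%R s D <= (expR (- x ^+ 2 / 2))%:E)%E.
Proof.
move=> mD s0 mE Dm; rewrite /normal_prob.
have s0' : s != 0 by rewrite gt_eqF.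
have mpdf c : measurable_fun D (fun y => (normal_pdf c s y)%:E).
  by apply/measurable_EFinP; apply: measurable_funTS; exact: measurable_normal_pdf.
apply: (@le_trans _ _ (\int[lebesgue_measure]_(y in D)
    ((expR (- x ^+ 2 / 2))%:E * (normal_pdf m s y)%:E))%E).
  apply: ge0_le_integral => //.
  - by move=> y _; rewrite lee_fin normal_pdf_ge0.
  - exact: mpdf.
  - by apply: measurable_funeM; exact: mpdf.
  - move=> y Dy; rewrite -EFinM lee_fin !normal_pdfE//.
    rewrite mulrCA; apply: ler_wpM2l; first exact: normal_peak_ge0.
    rewrite /normal_fun -expRD ler_expR subr0.
    have h := Dm _ Dy.
    have s2 : 0 < s ^+ 2 by rewrite exprn_gt0.
    rewrite -subr_ge0.
    have -> : - x ^+ 2 / 2 + - (y - m) ^+ 2 / (s ^+ 2 *+ 2) -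
      - y ^+ 2 / (s ^+ 2 *+ 2) = (m * (y - m) *+ 2 + m ^+ 2 - (x * s) ^+ 2) / (s ^+ 2 *+ 2).
      by field.
    by rewrite mE addrK divr_ge0// mulrn_wge0// ltW.
rewrite ge0_integralZl//; last 2 first.
- exact: mpdf.
- by move=> y _; rewrite lee_fin normal_pdf_ge0.
rewrite -[leRHS]mule1; apply: lee_wpmul2l; first by rewrite lee_fin expR_ge0.
rewrite -(integral_normal_pdf m s); apply: ge0_subset_integral => //.
- by apply/measurable_EFinP; exact: measurable_normal_pdf.
- by move=> y _; rewrite lee_fin normal_pdf_ge0.
Qed.

Lemma normal_prob_tail s x : 0 < s -> 0 <= x ->
  (normal_prob 0%R s [set y : R | (x * s <= `|y|)%R] <= (2 * expR (- x ^+ 2 / 2))%:E)%E.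
Proof.
move=> s0 x0.
rewrite norm_ge_setE.
apply: le_trans (measureU2 _ _ _) _ => //.
rewrite mulr2n mulrDl !mul1r EFinD; apply: leeD.
  apply: (@normal_prob_shift s x (x * s)) => // y /=; rewrite in_itv/= andbT => h.
  by rewrite mulr_ge0 ?subr_ge0// mulr_ge0// ltW.
apply: (@normal_prob_shift s x (- (x * s))) => //; first by rewrite sqrrN.
move=> y /=; rewrite in_itv/= => h.
by rewrite mulr_le0// ?subr_le0// oppr_le0 mulr_ge0// ltW.
Qed.

Definition gauss_const : R := (Num.sqrt (pi *+ 2))^-1.

Lemma gauss_const_gt0 : 0 < gauss_const.
Proof. by rewrite invr_gt0 sqrtr_gt0 mulrn_wgt0// pi_gt0. Qed.

Lemma gauss_const_le1 : gauss_const <= 1.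
Proof.
rewrite /gauss_const invf_le1; last by rewrite sqrtr_gt0 mulrn_wgt0// pi_gt0.
rewrite -[leLHS]sqrtr1; apply: ler_wsqrtr.
by have := @pi_ge2 R; lra.
Qed.

(** One standard deviation to the right of [y * s], the density is still at least
   its value at [(y + 1) * s], and the shift by one does not change the
   exponential rate. *)
Lemma normal_prob_tail_lower s y : 0 < s -> 0 <= y ->
  ((gauss_const * expR (- (y + 1) ^+ 2 / 2))%:E <=
   normal_prob 0%R s [set z : R | (y * s <= z)%R])%E.
Proof.
move=> s0 y0.
have s0' : s != 0 by rewrite gt_eqF.
pose I := `[y * s, (y + 1) * s]%classic.
have mI : measurable I by exact: measurable_itv.
have mpdf D : measurable_fun D (fun y => (normal_pdf 0 s y)%:E).
  by apply/measurable_EFinP; apply: measurable_funTS; exact: measurable_normal_pdf.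
have lei : y * s <= (y + 1) * s by rewrite ler_pM2r// lerDl.
have mH := measurable_ge (y * s).
apply: (@le_trans _ _ (normal_prob 0 s I)); last first.
  by apply: le_measure; rewrite ?inE// => z; rewrite /I /= in_itv /= => /andP[].
rewrite /normal_prob.
pose c := normal_peak s * expR (- (y + 1) ^+ 2 / 2).
apply: (@le_trans _ _ (\int[lebesgue_measure]_(z in I) (cst c%:E z))%E).
  rewrite integral_cst//= /I lebesgue_measure_itv/= lte_fin.
  have -> : y * s < (y + 1) * s by rewrite ltr_pM2r// ltrDl.
  rewrite -EFinD -EFinM lee_fin /c /gauss_const /normal_peak -mulrnAr.
  rewrite sqrtrM ?sqr_ge0// sqrtr_sqr gtr0_norm// invfM.
  set e := expR _; set k := (Num.sqrt _)^-1.
  by rewrite le_eqVlt; apply/orP; left; apply/eqP; field.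
apply: ge0_le_integral => //.
- move=> z _; rewrite /= lee_fin mulr_ge0 ?expR_ge0//; exact: normal_peak_ge0.
- exact: mpdf.
- move=> z; rewrite /I /= in_itv/= => /andP[z1 z2].
  rewrite lee_fin normal_pdfE// /c; apply: ler_wpM2l; first exact: normal_peak_ge0.
  rewrite /normal_fun ler_expR subr0 !mulNr lerN2.
  have s2 : 0 < s ^+ 2 by rewrite exprn_gt0.
  rewrite ler_pdivrMr; last by rewrite mulrn_wgt0.
  have -> : (y + 1) ^+ 2 / 2 * (s ^+ 2 *+ 2) = ((y + 1) * s) ^+ 2 by field.
  rewrite ler_sqr ?nnegrE//; first exact: le_trans (mulr_ge0 y0 (ltW s0)) z1.
  by rewrite mulr_ge0 ?addr_ge0// ltW.
Qed.
End gaussian_tails.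

(** * Increments of Brownian motion *)

Section increments.
Context {R : realType} {d : measure_display} {T : measurableType d}.
Variables (P : probability T R) (W : R -> {RV P >-> R}).

(** The increment is divided by its standard deviation; by the convention on
   division, it is 0 when [s = t], which the bounds below allow. *)
Definition ninc (s t : R) (w : T) : R := (W t w - W s w) / Num.sqrt (t - s).

Lemma measurable_ninc s t : measurable_fun setT (ninc s t).
Proof. by apply: measurable_funM => //; exact: measurable_funB. Qed.

Lemma measurable_ninc_preimage s t (B : set R) : measurable B ->
  measurable [set w | B (ninc s t w)].
Proof.
by move=> mB; rewrite -[X in measurable X]setTI; exact: measurable_ninc.
Qed.

Lemma ninc_diag s w : ninc s s w = 0.
Proof. by rewrite /ninc subrr mul0r. Qed.

Lemma nincE s t w : s <= t -> W t w - W s w = Num.sqrt (t - s) * ninc s t w.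
Proof.
rewrite le_eqVlt => /orP[/eqP <-|st]; first by rewrite ninc_diag mulr0 subrr.
by rewrite mulrC divfK// gt_eqF// sqrtr_gt0 subr_gt0.
Qed.

Hypothesis hW : standard_brownian_motion W.

Lemma ninc_normal s t (B : set R) : 0 <= s -> s < t -> measurable B ->
  P [set w | B (ninc s t w)] =
  normal_prob 0 (Num.sqrt (t - s)) [set y | B (y / Num.sqrt (t - s))].
Proof.
case: hW => _ _ h _ s0 st mB; rewrite -(h s t)//.
rewrite -[X in measurable X]setTI.
by apply: (measurable_funM _ (measurable_cst _)).
Qed.

Lemma ninc_tail s t x : 0 <= s -> s <= t -> 0 <= x ->
  (P [set w | (x <= `|ninc s t w|)%R] <= (2 * expR (- x ^+ 2 / 2))%:E)%E.
Proof.
move=> s0; rewrite le_eqVlt => /orP[/eqP <-|st] x0.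
  have [->|xn0] := eqVneq x 0.
    apply: le_trans (probability_le1 _ _) _.
      by have := measurable_ninc_preimage s s (measurable_norm_ge 0).
    by rewrite expr0n/= oppr0 mul0r expR0 mulr1 lee_fin; lra.
  rewrite (_ : mkset _ = set0) ?measure0 ?lee_fin ?mulr_ge0 ?expR_ge0//.
  apply/seteqP; split=> // w /=; rewrite ninc_diag normr0.
  by move=> /(conj x0)/andP; rewrite -eq_le eq_sym (negbTE xn0).
have sg : 0 < Num.sqrt (t - s) by rewrite sqrtr_gt0 subr_gt0.
have := ninc_normal s0 st (measurable_norm_ge x) => /= ->.
rewrite (_ : mkset _ = [set y : R | x * Num.sqrt (t - s) <= `|y|]).
  exact: normal_prob_tail.
by apply: eq_set => y; rewrite normrM normfV (gtr0_norm sg) ler_pdivlMr.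
Qed.

Lemma ninc_tail_lower s t y : 0 <= s -> s < t \/ s = t /\ y = 0 -> 0 <= y ->
  ((gauss_const * expR (- (y + 1) ^+ 2 / 2))%:E <=
   P [set w | (y <= ninc s t w)%R])%E.
Proof.
move=> s0 [st|[<- ->]] y0; last first.
  rewrite (_ : mkset _ = setT) ?probability_setT; last first.
    by apply/seteqP; split=> // w _ /=; rewrite ninc_diag.
  rewrite lee_fin; apply: mulr_ile1; rewrite ?expR_ge0 ?gauss_const_le1//.
    exact: ltW gauss_const_gt0.
have sg : 0 < Num.sqrt (t - s) by rewrite sqrtr_gt0 subr_gt0.
have := ninc_normal s0 st (measurable_ge y) => /= ->.
rewrite (_ : mkset _ = [set z : R | y * Num.sqrt (t - s) <= z]).
  exact: normal_prob_tail_lower.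
by apply: eq_set => z; rewrite ler_pdivlMr.
Qed.

Lemma ninc_indep (n : nat) (t : nat -> R) (B : nat -> set R) :
  0 <= t 0%N -> {homo t : i j / (i <= j)%N >-> i <= j} ->
  (forall i, measurable (B i)) ->
  P (\big[setI/setT]_(i < n) [set w | B i (ninc (t i) (t i.+1) w)]) =
  (\prod_(i < n) P [set w | B i (ninc (t i) (t i.+1) w)])%E.
Proof.
case: hW => _ h _ _ t0 tmono mB.
have := h n t t0 tmono (fun i => [set y | B i (y / Num.sqrt (t i.+1 - t i))]).
have mB' (i : 'I_n) : measurable [set y | B i (y / Num.sqrt (t i.+1 - t i))].
  rewrite -[X in measurable X]setTI.
  by apply: (measurable_funM _ (measurable_cst _)).
move=> /(_ mB') hE.
rewrite -(bigcap_mkord n (fun i => [set w | B i (ninc (t i) (t i.+1) w)])).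
apply: etrans hE; congr (P _).
apply/seteqP; split=> w Hw i /= ni; last exact: (Hw (Ordinal ni) I).
exact: Hw (ltn_ord i).
Qed.
End increments.

(** Regrouping indices into consecutive blocks of length [I]; it applies both to
   intersections of events and to products of probabilities. *)
Lemma big_blocks (S : Type) (idx : S) (op : Monoid.com_law idx) (F : nat -> S)
    (s : seq nat) (N I : nat) : (0 < I)%N -> uniq s -> {in s, forall j, (j < N)%N} ->
  \big[op/idx]_(m < N * I) (if (m %/ I)%N \in s then F m else idx) =
  \big[op/idx]_(j <- s) \big[op/idx]_(i < I) F (j * I + i)%N.
Proof.
move=> I0 us sN.
pose G m := if (m %/ I)%N \in s then F m else idx.
rewrite -(big_mkord xpredT G) big_nat_mul.
have perm_s : perm_eq [seq j <- index_iota 0 N | j \in s] s.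
  apply: uniq_perm => //; first by rewrite filter_uniq// iota_uniq.
  move=> j; rewrite mem_filter mem_index_iota /=.
  by case: (boolP (j \in s)) => // /sN ->.
rewrite -(perm_big _ perm_s) big_filter [RHS]big_mkcond; apply: eq_bigr => j _.
rewrite mulSn -{1}[(j * I)%N]add0n big_addn addnK big_mkord.
rewrite (eq_bigr (fun i : 'I_I => if j \in s then F (j * I + i)%N else idx)).
  by case: ifP => // _; rewrite big1.
move=> i _; rewrite /G addnC divnMDl// (divn_small (ltn_ord i)) addn0.
by case: ifP.
Qed.

Section blocks.
Context {R : realType} {d : measure_display} {T : measurableType d}.
Variables (P : probability T R) (W : R -> {RV P >-> R}).
Hypothesis hW : standard_brownian_motion W.
Variables (t : nat -> R) (B : nat -> set R) (I : nat).
Hypotheses (t0 : 0 <= t 0%N) (I0 : (0 < I)%N)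
  (tmono : {homo t : i j / (i <= j)%N >-> i <= j})
  (mB : forall i, measurable (B i)).

Definition inc_event m := [set w | B m (ninc W (t m) (t m.+1) w)].

Definition block_event j := \big[setI/setT]_(i < I) inc_event (j * I + i).

Lemma measurable_block_event j : measurable (block_event j).
Proof.
apply: big_ind => //; first exact: measurableI.
by move=> i _; exact: measurable_ninc_preimage.
Qed.

Lemma P_block_event j :
  P (block_event j) = (\prod_(i < I) P (inc_event (j * I + i)))%E.
Proof.
pose t' i := t (j * I + i)%N; pose B' i := B (j * I + i)%N.
have E i : [set w | B' i (ninc W (t' i) (t' i.+1) w)] = inc_event (j * I + i).
  by rewrite /inc_event /t' addnS.
transitivity (P (\big[setI/setT]_(i < I) [set w | B' i (ninc W (t' i) (t' i.+1) w)])).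
  by congr (P _); apply: eq_bigr => i _; rewrite E.
rewrite (ninc_indep hW)//.
- by apply: eq_bigr => i _; rewrite E.
- by rewrite (le_trans t0)// tmono.
- by move=> m n mn; rewrite tmono// leq_add2l.
- by move=> i; exact: mB.
Qed.

(** The increments of distinct blocks being distinct, imposing nothing on the
   other blocks turns the product rule of the increments into one for blocks. *)
Lemma block_event_product_rule (s : seq nat) : uniq s ->
  P (\big[setI/setT]_(j <- s) block_event j) = (\prod_(j <- s) P (block_event j))%E.
Proof.
move=> us.
pose N := (\max_(j <- s) j).+1.
have sN : {in s, forall j, (j < N)%N}.
  by move=> j js; rewrite /N ltnS; exact: leq_bigmax_seq.
pose B' m := if (m %/ I)%N \in s then B m else setT.
have mB' m : measurable (B' m) by rewrite /B'; case: ifP.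
have := ninc_indep hW (N * I) t0 tmono mB'.
have E m : [set w | B' m (ninc W (t m) (t m.+1) w)] =
    if (m %/ I)%N \in s then inc_event m else setT.
  by rewrite /B'; case: ifP.
rewrite (eq_bigr (fun m : 'I_(N * I) => if (m %/ I)%N \in s then inc_event m else setT)); last first.
  by move=> m _; exact: E.
rewrite big_blocks// => ->.
rewrite (eq_bigr _ (fun j _ => P_block_event j)) -(@big_blocks _ _ _ (fun m => P (inc_event m)) s N I)//.
apply: eq_bigr => m _.
by rewrite E; case: ifP => // _; rewrite probability_setT.
Qed.
End blocks.

(** * Oscillations of Brownian paths *)

Section loglog.
Context {R : realType}.
Implicit Types (c s e : R).

(** The terms [n ^ (- (1 + e))] are dominated by the increments of the bounded
   sequence [n ^ (- e)]. *)
Lemma expR_ln_telescope e (n : nat) : 0 < e -> (0 < n)%N ->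
  e * expR (- (1 + e) * ln n.+1%:R) <=
  expR (- e * ln n%:R) - expR (- e * ln n.+1%:R) :> R.
Proof.
move=> e0 n0.
have n0' : 0 < n%:R :> R by rewrite ltr0n.
have n1 : 0 < n.+1%:R :> R by rewrite ltr0n.
rewrite lerBrDr opprD mulrDl mulN1r expRD expRN lnK// ?posrE// mulrA.
rewrite -[X in _ + X]mul1r -mulrDl addrC.
have -> : - e * ln (n%:R : R) = e * (ln n.+1%:R - ln n%:R) + - e * ln n.+1%:R.
  by ring.
rewrite expRD; apply: ler_wpM2r; first exact: expR_ge0.
apply: le_trans (expR_ge1Dx _); rewrite lerD2l; apply: ler_wpM2l; first exact: ltW.
(* it remains to see that [ln (n / (n + 1)) <= - 1 / (n + 1)] *)
rewrite -lerN2 opprB -ln_div ?posrE//.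
have -> : n%:R / n.+1%:R = 1 + (- n.+1%:R^-1) :> R.
  by rewrite -natr1; field; rewrite natr1 gt_eqF.
by apply: le_ln1Dx; rewrite ltrN2 invf_lt1// ltr1n.
Qed.

Lemma expR_ln_sum_bounded e : 0 < e ->
  exists B : R, forall n, \sum_(0 <= k < n) expR (- (1 + e) * ln k%:R) <= B.
Proof.
move=> e0; exists (2 + e^-1) => n.
have H m : \sum_(0 <= k < m.+2) expR (- (1 + e) * ln k%:R) <=
    2 + e^-1 * (1 - expR (- e * ln m.+1%:R)).
  elim: m => [|m IH].
    rewrite big_nat_recr//= big_nat1 ln1 ln0// !mulr0 expR0 subrr mulr0 addr0.
    by rewrite -[leRHS]/(1 + 1 : R).
  rewrite big_nat_recr//=.
  have := expR_ln_telescope e0 (ltn0Sn m).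
  rewrite -ler_pdivlMl// => h.
  by apply: le_trans (lerD IH h) _; rewrite -addrA -mulrDr addrA subrK.
apply: (@le_trans _ _ (\sum_(0 <= k < n.+2) expR (- (1 + e) * ln k%:R))).
  rewrite !big_nat_recr//= ?leqW// -addrA lerDl addr_ge0// expR_ge0//.
apply: (le_trans (H n)); by rewrite lerD2l ler_piMr ?invr_ge0 ?(ltW e0)// gerBl expR_ge0.
Qed.

Lemma lnlnX c (n : nat) : 1 < c -> (0 < n)%N ->
  ln (ln (c ^+ n)) = ln (ln c) + ln n%:R.
Proof.
move=> c1 n0; rewrite lnXn ?(lt_trans _ c1)// -[_ *+ _]mulr_natr lnM// posrE ?ltr0n//.
exact: ln_gt0.
Qed.

Lemma lnln_sum_bounded c s : 1 < c -> 1 < s ->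
  exists B : R, forall n, \sum_(0 <= k < n) expR (- s * ln (ln (c ^+ k))) <= B.
Proof.
move=> c1 s1; have e0 : 0 < s - 1 by rewrite subr_gt0.
have [B HB] := expR_ln_sum_bounded e0.
pose K := expR (- s * ln (ln c)).
have K0 : 0 <= K by exact: expR_ge0.
exists (1 + K * B) => n; case: n => [|n].
  rewrite big_geq// addr_ge0// mulr_ge0//.
  by have := HB 0%N; rewrite big_geq.
rewrite big_nat_recl//= expr0 ln1 ln0// mulr0 expR0 lerD2l.
apply: (@le_trans _ _ (\sum_(0 <= i < n) (K * expR (- s * ln i.+1%:R)))).
  by apply: ler_sum => i _; rewrite lnlnX// mulrDr expRD.
rewrite -mulr_sumr; apply: ler_wpM2l => //; apply: le_trans (HB n.+1).
rewrite [leRHS]big_nat_recl//= (_ : 1 + (s - 1) = s) ?lerDr ?expR_ge0//.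
by rewrite addrC subrK.
Qed.

Lemma lnln_cvgX c : 1 < c -> ln (ln (c ^+ n)) @[n --> \oo] --> +oo.
Proof.
move=> c1; apply/cvgryPge => A.
near=> n.
have n0 : (0 < n)%N by near: n; exists 1%N.
rewrite lnlnX// addrC -lerBlDr -[leLHS]expRK ler_ln ?posrE ?expR_gt0 ?ltr0n//.
near: n; exact: nbhs_infty_ger.
Unshelve. all: by end_near. Qed.

(** The normalization of the law of the iterated logarithm, without [sqrt 2]. *)
Definition phi (t : R) := Num.sqrt (t * ln (ln t)).

End loglog.

Section chaining.
Context {R : realType}.

(** Every dyadic point of rank [m.+1] is at distance at most one step of that
   rank from a dyadic point of rank [m], and the bounds on the steps of all ranks
   add up to [y]. *)
Lemma dyadic_chain (f : R -> R) (t L y q : R) : 0 < q < 1 -> 0 <= y ->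
  (forall m k, (k < 2 ^ m)%N ->
    `|f (t + k.+1%:R * (L / 2 ^+ m)) - f (t + k%:R * (L / 2 ^+ m))| <=
    y * (1 - q) * q ^+ m) ->
  forall m k, (k <= 2 ^ m)%N -> `|f (t + k%:R * (L / 2 ^+ m)) - f t| <= y.
Proof.
move=> /andP[q0 q1] y0 H m k km.
apply: (@le_trans _ _ (y * (1 - q ^+ m.+1))); last first.
  by rewrite ler_piMr// gerBl exprn_ge0// ltW.
elim: m k km => [|m IH] k.
  rewrite expn0 expr1; case: k => [_|[|//] _].
    by rewrite mul0r addr0 subrr normr0 mulr_ge0// subr_ge0 ltW.
  by have := H 0%N 0%N isT; rewrite mul0r addr0 mulr1.
have E (j : nat) : t + (j.*2)%:R * (L / 2 ^+ m.+1) = t + j%:R * (L / 2 ^+ m).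
  rewrite -muln2 natrM exprS; field.
  by rewrite expf_neq0.
have mono : y * (1 - q ^+ m.+1) <= y * (1 - q ^+ m.+2).
  apply: ler_wpM2l => //; rewrite lerD2l lerN2 exprS ler_piMl ?exprn_ge0// ltW//.
rewrite -(odd_double_half k).
case: (odd k) => /=; last first.
  rewrite add0n expnS mul2n leq_double => km.
  by rewrite E (le_trans (IH _ km)).
rewrite add1n expnS mul2n ltn_double => km.
have := H m.+1 (k./2).*2; rewrite expnS mul2n ltn_double => /(_ km) h.
have := IH _ (ltnW km); rewrite -E => h2.
have -> : f (t + (k./2).*2.+1%:R * (L / 2 ^+ m.+1)) - f t =
   (f (t + (k./2).*2.+1%:R * (L / 2 ^+ m.+1)) - f (t + (k./2).*2%:R * (L / 2 ^+ m.+1))) +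
   (f (t + (k./2).*2%:R * (L / 2 ^+ m.+1)) - f t) by ring.
apply: le_trans (ler_normD _ _) _; apply: le_trans (lerD h h2) _.
by rewrite le_eqVlt; apply/orP; left; apply/eqP; rewrite !exprS; ring.
Qed.

Lemma dyadic_chain_continuous (f : R -> R) (t L y q : R) :
  {within `[0, +oo[, continuous f} -> 0 <= t -> 0 < L -> 0 < q < 1 -> 0 <= y ->
  (forall m k, (k < 2 ^ m)%N ->
    `|f (t + k.+1%:R * (L / 2 ^+ m)) - f (t + k%:R * (L / 2 ^+ m))| <=
    y * (1 - q) * q ^+ m) ->
  forall s, t <= s <= t + L -> `|f s - f t| <= y.
Proof.
move=> cf t0 L0 q01 y0 H s /andP[ts stL].
move: ts; rewrite le_eqVlt => /orP[/eqP <-|ts]; first by rewrite subrr normr0.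
have /continuous_within_itvcyP[cs _] := cf.
have s0 : s \in `]0, +oo[ by rewrite in_itv/= andbT (le_lt_trans t0).
have /cvgrPdist_le cfs := cs s s0.
apply/ler_addgt0Pr => e e0.
have [dl /= dl0 Hd] := cfs e e0.
have [m Hm] : exists m, L / 2 ^+ m < dl.
  have : L / 2 ^+ m @[m --> \oo] --> L * 0.
    apply: cvgMr; under eq_fun do rewrite -exprVn.
    by apply: cvg_expr; rewrite ger0_norm ?invr_ge0// invf_lt1// ltr1n.
  rewrite mulr0 => /cvgrPdist_lt/(_ dl dl0)[m _ /(_ m (leqnn m))].
  by rewrite /= sub0r normrN => /(le_lt_trans (ler_norm _)); exists m.
pose h := L / 2 ^+ m.
have h0 : 0 < h by rewrite divr_gt0// exprn_gt0.
pose k := Num.truncn ((s - t) / h).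
have x0 : 0 <= (s - t) / h by apply: divr_ge0; [rewrite subr_ge0|]; exact: ltW.
have /andP[k1 k2] := truncn_itv x0.
have km : (k <= 2 ^ m)%N.
  rewrite -(ler_nat R) (le_trans k1)// ler_pdivrMr// natrX mulrC /h divfK ?expf_neq0//.
  by rewrite lerBlDl.
have := dyadic_chain q01 y0 H km => hk.
have dk : `|s - (t + k%:R * h)| < dl.
  rewrite opprD addrA ger0_norm; last by rewrite subr_ge0 -ler_pdivlMr.
  apply: lt_trans Hm; rewrite -/h.
  by move: k2; rewrite ltr_pdivrMr// -natr1 mulrDl mul1r -/k; lra.
have := Hd _ dk => hs.
have -> : f s - f t = (f (t + k%:R * h) - f t) + (f s - f (t + k%:R * h)) by ring.
exact: le_trans (ler_normD _ _) (lerD hk hs).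
Qed.
End chaining.

Section oscillation.
Context {R : realType} {d : measure_display} {T : measurableType d}.
Variables (P : probability T R) (W : R -> {RV P >-> R}).
Hypothesis hW : standard_brownian_motion W.

(** With the ratio [4 / 5], the squared threshold at rank [m] is proportional to
   [(32 / 25) ^+ m], which beats the number [2 ^ m] of increments of rank [m];
   [24 <= x] makes the resulting geometric ratio at most [1 / 2]. *)
Lemma oscillation_level (x : R) (m : nat) : 24 <= x ->
  2 ^+ m * (2 * expR (- (x * (Num.sqrt (2 ^+ m) * (5^-1 * (4 / 5) ^+ m))) ^+ 2 / 2))
  <= 2 * expR (- x ^+ 2 / 50) * 2^-1 ^+ m :> R.
Proof.
move=> x24.
have -> : - (x * (Num.sqrt (2 ^+ m) * (5^-1 * (4 / 5) ^+ m))) ^+ 2 / 2 =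
    - (x ^+ 2 / 50) * (32 / 25) ^+ m :> R.
  have -> : (32 / 25) ^+ m = 2 ^+ m * (4 / 5) ^+ m * (4 / 5) ^+ m :> R.
    by rewrite -!exprMn; congr (_ ^+ m); field.
  by rewrite !exprMn sqr_sqrtr ?exprn_ge0//; field.
have x2 : 576 <= x ^+ 2 by nra.
have b : 1 + m%:R * (7 / 25) <= (32 / 25) ^+ m :> R.
  elim: m => [|m IH]; first by rewrite mul0r addr0.
  rewrite exprS -natr1.
  have : 0 <= m%:R :> R by [].
  by move: IH; set y := _ ^+ m; set k := m%:R; nra.
have e4 : expR (- (x ^+ 2 / 50 * (7 / 25))) <= 4^-1 :> R.
  rewrite expRN -div1r ler_pdivrMr ?expR_gt0//.
  by have := expR_ge1Dx (x ^+ 2 / 50 * (7 / 25)); lra.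
apply: (@le_trans _ _ (2 ^+ m * (2 * (expR (- x ^+ 2 / 50) * 4^-1 ^+ m)) : R)).
  apply: ler_wpM2l; first exact: exprn_ge0.
  apply: ler_wpM2l => //.
  apply: (@le_trans _ _ (expR (- x ^+ 2 / 50 + (- (x ^+ 2 / 50 * (7 / 25))) * m%:R))).
    rewrite ler_expR; set y := _ ^+ m in b *; set k := m%:R in b *.
    by nra.
  rewrite expRD; apply: ler_wpM2l; first exact: expR_ge0.
  by rewrite expRM_natr lerXn2r// nnegrE ?expR_ge0.
rewrite le_eqVlt; apply/orP; left; apply/eqP.
have -> : 4^-1 ^+ m = 2^-1 ^+ m * 2^-1 ^+ m :> R.
  by rewrite -!exprMn; congr (_ ^+ m); field.
rewrite exprVn; field.
by rewrite expf_neq0.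
Qed.

(** Chaining over dyadic points: a union bound over the Gaussian tails of the
   dyadic increments controls the path at dyadic points, and continuity does the
   rest. *)
Lemma oscillation_prob (t L x : R) : 0 <= t -> 0 < L -> 24 <= x ->
  exists E, [/\ measurable E, (P E <= (4 * expR (- x ^+ 2 / 50))%:E)%E &
    forall w, ~ E w -> {within `[0, +oo[, continuous (fun s => W s w)} ->
      forall s, t <= s <= t + L -> `|W s w - W t w| <= x * Num.sqrt L].
Proof.
move=> t0 L0 x24.
have x0 : 0 <= x by lra.
pose h (m : nat) := L / 2 ^+ m.
have h0 m : 0 < h m by rewrite divr_gt0// exprn_gt0.
pose a m : R := x * (Num.sqrt (2 ^+ m) * (5^-1 * (4 / 5) ^+ m)).
have a0 m : 0 <= a m by rewrite !mulr_ge0 ?sqrtr_ge0 ?invr_ge0 ?exprn_ge0 ?divr_ge0.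
pose F m k := [set w | a m <= `|ninc W (t + k%:R * h m) (t + k.+1%:R * h m) w|].
have mF m k : measurable (F m k).
  exact: measurable_ninc_preimage (measurable_norm_ge _).
pose G m := \big[setU/set0]_(k < 2 ^ m) F m k.
have mG m : measurable (G m) by apply: bigsetU_measurable.
have PG m : (P (G m) <= (2 * expR (- x ^+ 2 / 50) * 2^-1 ^+ m)%:E)%E.
  apply: le_trans (Boole_inequality P _) _; first by move=> *; exact: mF.
  apply: (@le_trans _ _ (\sum_(k < 2 ^ m) (2 * expR (- a m ^+ 2 / 2))%:E)%E).
    apply: lee_sum => k _; apply: (ninc_tail hW) => //.
      by rewrite addr_ge0// mulr_ge0// ltW.
    by rewrite lerD2l ler_pM2r// ler_nat.
  rewrite sumEFin lee_fin sumr_const card_ord -[leLHS]mulr_natl natrX.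
  exact: oscillation_level.
exists (\bigcup_m G m); split.
- exact: bigcupT_measurable.
- apply: (@le_trans _ _ (\sum_(m <oo) P (G m))%E).
    by apply: measure_sigma_subadditive => //; exact: bigcupT_measurable.
  apply: lime_le; first by apply: is_cvg_nneseries => *; exact: measure_ge0.
  apply: nearW => n.
  apply: (@le_trans _ _ (\sum_(0 <= m < n) (2 * expR (- x ^+ 2 / 50) * 2^-1 ^+ m)%:E)%E).
    by apply: lee_sum => m _; exact: PG.
  rewrite sumEFin lee_fin -mulr_sumr.
  have -> : 4 * expR (- x ^+ 2 / 50) = 2 * expR (- x ^+ 2 / 50) * 2 by ring.
  apply: ler_wpM2l; first by rewrite mulr_ge0// expR_ge0.
  have : \sum_(0 <= m < n) 2^-1 ^+ m = 2 * (1 - 2^-1 ^+ n) :> R.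
    elim: n => [|n IH]; first by rewrite big_geq// expr0 subrr mulr0.
    by rewrite big_nat_recr//= IH exprS; field.
  by move=> ->; rewrite ler_piMr// gerBl exprn_ge0// invr_ge0.
- move=> w nE cw; apply: (@dyadic_chain_continuous _ _ _ _ _ (4 / 5)) => //.
  + by rewrite !ltr_pdivlMr// ltr_pdivrMr//; lra.
  + by rewrite mulr_ge0// sqrtr_ge0.
  move=> m k km.
  have nF : ~ F m k w.
    move=> Fw; apply: nE; exists m => //; rewrite /G -bigcup_mkord.
    by exists k.
  have le_t : t + k%:R * h m <= t + k.+1%:R * h m.
    by rewrite lerD2l ler_pM2r// ler_nat.
  rewrite (nincE _ _ le_t) normrM (ger0_norm (sqrtr_ge0 _)).
  move/negP: nF; rewrite -ltNge => /ltW nF.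
  apply: (le_trans (ler_wpM2l (sqrtr_ge0 _) nF)).
  have -> : t + k.+1%:R * h m - (t + k%:R * h m) = h m by rewrite -natr1; ring.
  rewrite /a /h le_eqVlt; apply/orP; left; apply/eqP.
  have -> : Num.sqrt L = Num.sqrt (L / 2 ^+ m) * Num.sqrt (2 ^+ m).
    by rewrite -sqrtrM ?divr_ge0 ?exprn_ge0 ?(ltW L0)// divfK// expf_neq0.
  by field.
Qed.

(** The threshold [10 * sqrt (ln (ln (c ^+ j)))] makes the probability of a large
   oscillation at most [4 * expR (- 2 * ln (ln (c ^+ j)))], which is of the order
   of [j ^ -2] and hence summable. *)
Lemma oscillation_ae (c : R) (tau L : nat -> R) : 1 < c ->
  (forall j, 0 <= tau j) -> (forall j, 0 < L j) ->
  {ae P, forall w, \forall j \near \oo, forall s, tau j <= s <= tau j + L j ->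
     `|W s w - W (tau j) w| <= 10 * Num.sqrt (L j * ln (ln (c ^+ j)))}.
Proof.
move=> c1 tau0 L0.
pose x j : R := Num.max 24 (10 * Num.sqrt (ln (ln (c ^+ j)))).
have x24 j : 24 <= x j by rewrite le_max lexx.
have /choice[E HE] := fun j => oscillation_prob (tau0 j) (L0 j) (x24 j).
have lnlny := @lnln_cvgX R c c1.
have nx : \forall j \near \oo, x j = 10 * Num.sqrt (ln (ln (c ^+ j))) /\ 0 <= ln (ln (c ^+ j)).
  near=> j; split; last by near: j; move/cvgryPge : lnlny; apply.
  apply/max_idPr; have -> : 24 = 10 * Num.sqrt ((24 / 10) ^+ 2) :> R.
    by rewrite sqrtr_sqr ger0_norm ?divr_ge0//; field.
  rewrite ler_pM2l//; apply: ler_wsqrtr.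
  by near: j; move/cvgryPge : lnlny; apply.
have [B HB] := @lnln_sum_bounded R c 2 c1 (ltr1n _ 2).
have c4 n : \sum_(0 <= k < n) (4 * expR (- 2 * ln (ln (c ^+ k)))) <= 4 * B.
  by rewrite -mulr_sumr ler_pM2l.
have u0 n : 0 <= 4 * expR (- 2 * ln (ln (c ^+ n))) by rewrite mulr_ge0// expR_ge0.
have aeE : {ae P, forall w, \forall n \near \oo, ~ E n w}.
  apply: (eventually_notin _ u0 c4); first by move=> n; case: (HE n).
  near=> n; have [_ + _] := HE n.
  have [-> l0] : x n = 10 * Num.sqrt (ln (ln (c ^+ n))) /\ 0 <= ln (ln (c ^+ n)).
    by near: n.
  rewrite exprMn sqr_sqrtr// => /le_trans; apply.
  rewrite lee_fin ler_pM2l// ler_expR le_eqVlt; apply/orP; left; apply/eqP.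
  by field.
case: hW => _ _ _ cW.
apply: filterS2 aeE cW => w nE cw.
near=> j => s sj.
have [_ _ H] := HE j.
have [xE l0] : x j = 10 * Num.sqrt (ln (ln (c ^+ j))) /\ 0 <= ln (ln (c ^+ j)).
  by near: j.
have nEj : ~ E j w by near: j.
have := H w nEj cw s sj; rewrite xE => /le_trans; apply.
by rewrite -mulrA -sqrtrM// (mulrC (L j)).
Unshelve. all: by end_near. Qed.
End oscillation.

Section phi_facts.
Context {R : realType}.
Implicit Types (c s t : R).

Lemma geometric_bracket c t : 1 < c -> 1 <= t -> exists j, c ^+ j <= t < c ^+ j.+1.
Proof.
move=> c1 t1; have t0 : 0 < t by exact: lt_le_trans t1.
have lc : 0 < ln c by exact: ln_gt0.
have q0 : 0 <= ln t / ln c by rewrite divr_ge0 ?ln_ge0// ltW.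
have /andP[] := truncn_itv q0; set j := Num.truncn _ => j1 j2.
have c0 : 0 < c by exact: lt_trans c1.
exists j; apply/andP; split.
  by rewrite -ler_ln ?posrE ?exprn_gt0// lnXn// -mulr_natl -ler_pdivlMr.
by rewrite -ltr_ln ?posrE ?exprn_gt0// lnXn// -mulr_natl -ltr_pdivrMr.
Qed.

Lemma geometric_ge_expR1 c : 1 < c -> exists N, expR 1 <= c ^+ N.
Proof.
move=> c1; have e1 : 1 <= expR 1 :> R by rewrite -[leLHS]expR0 ler_expR.
by have [j /andP[_ /ltW]] := geometric_bracket c1 e1; exists j.+1.
Qed.

Lemma lnln_ge0 t : expR 1 <= t -> 0 <= ln (ln t).
Proof.
move=> t1; have t0 : 0 < t by apply: lt_le_trans t1; exact: expR_gt0.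
by apply: ln_ge0; rewrite -[leLHS]expRK ler_ln ?posrE ?expR_gt0.
Qed.

Lemma le_lnln s t : expR 1 <= s -> s <= t -> ln (ln s) <= ln (ln t).
Proof.
move=> s1 st; have s0 : 0 < s by apply: lt_le_trans s1; exact: expR_gt0.
have ls : 1 <= ln s by rewrite -[leLHS]expRK ler_ln ?posrE ?expR_gt0.
have lst : ln s <= ln t by rewrite ler_ln// posrE// (lt_le_trans s0).
have ls0 : 0 < ln s by exact: lt_le_trans ls.
by rewrite ler_ln ?posrE// (lt_le_trans ls0).
Qed.

Lemma le_phi s t : expR 1 <= s -> s <= t -> phi s <= phi t.
Proof.
move=> s1 st; apply: ler_wsqrtr; apply: ler_pM => //.
- by rewrite (le_trans _ s1)// expR_ge0.
- exact: lnln_ge0.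
- exact: le_lnln.
Qed.

Lemma phi_ge0 t : 0 <= phi t. Proof. exact: sqrtr_ge0. Qed.

Lemma phi_cvg : @phi R x @[x --> +oo] --> +oo.
Proof.
apply/cvgryPge => A; near=> t.
have et : expR (expR 1) <= t by near: t; apply: nbhs_pinfty_ge; exact: num_real.
have t0 : 0 < t by apply: lt_le_trans et; exact: expR_gt0.
have lt : expR 1 <= ln t by rewrite -[leLHS]expRK ler_ln ?posrE ?expR_gt0.
have l2 : 1 <= ln (ln t).
  rewrite -[leLHS]expRK ler_ln ?posrE ?expR_gt0//.
  by rewrite (lt_le_trans _ lt)// expR_gt0.
apply: (@le_trans _ _ `|A|); first exact: ler_norm.
rewrite -sqrtr_sqr; apply: ler_wsqrtr; apply: (@le_trans _ _ t).
  by near: t; apply: nbhs_pinfty_ge; exact: num_real.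
by rewrite ler_peMr// ltW.
Unshelve. all: by end_near. Qed.

(** These two properties are all that the comparison of the mean with a finite
   combination of values of the path requires. *)
Definition loglog_modulus (f : R -> R) := forall e, 0 < e -> exists2 dl, 0 < dl &
  exists T, forall s t, T <= t -> t <= s <= (1 + dl) * t -> `|f s - f t| <= e * phi s.

(** The constant is the one that [oscillation_ae] yields on the intervals
   [0, 2 ^ (j + 1)]. *)
Definition loglog_bounded (f : R -> R) :=
  exists T, forall t, T <= t -> `|f t| <= 20 * phi t.

End phi_facts.

Section brownian_paths.
Context {R : realType} {d : measure_display} {T : measurableType d}.
Variables (P : probability T R) (W : R -> {RV P >-> R}).
Hypothesis hW : standard_brownian_motion W.

Lemma brownian_loglog_bounded : {ae P, forall w, loglog_bounded (W ^~ w)}.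
Proof.
have := oscillation_ae (tau := fun=> 0) (L := fun j => 2 ^+ j.+1) hW (ltr1n R 2)
  (fun=> lexx 0) (fun j => exprn_gt0 _ (ltr0Sn R 1)).
case: hW => W0 _ _ _; apply: filterS2 W0 => w W0 [N _ HN].
have [N' HN'] := geometric_ge_expR1 (ltr1n R 2).
exists (Num.max (expR 1) (2 ^+ (maxn N N'))) => t; rewrite ge_max => /andP[t1 tN].
have t0 : 1 <= t by apply: le_trans t1; rewrite -[leLHS]expR0 ler_expR.
have [j /andP[jt tj]] := geometric_bracket (ltr1n R 2) t0.
have Nj : (maxn N N' <= j)%N.
  by have := le_lt_trans tN tj; rewrite ltr_eXn2l// ltr1n.
move: Nj; rewrite geq_max => /andP[Nj j2].
have := HN j Nj t; rewrite W0 subr0 add0r => /(_ _)/le_trans; apply.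
  by rewrite (le_trans _ t0)//= ltW.
have ej : expR 1 <= 2 ^+ j :> R.
  by apply: le_trans HN' _; rewrite ler_eXn2l// ltr1n.
have l0 := lnln_ge0 ej.
have -> : 20 * phi t = 10 * (2 * phi t) by ring.
rewrite ler_pM2l// -[X in _ <= X * _]ger0_norm// -sqrtr_sqr -sqrtrM ?sqr_ge0//.
apply: ler_wsqrtr; rewrite exprS -!mulrA.
have := le_lnln ej jt => ll.
rewrite ler_pM2l// (@le_trans _ _ (t * ln (ln t)))//.
  by apply: ler_pM => //; rewrite exprn_ge0.
have tl : 0 <= t * ln (ln t) by rewrite mulr_ge0 ?(le_trans l0 ll)// (le_trans _ t0).
by lra.
Qed.

Lemma brownian_loglog_modulus : {ae P, forall w, loglog_modulus (W ^~ w)}.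
Proof.
pose eps (m : nat) : R := m.+1%:R^-1.
suff H m : {ae P, forall w, exists2 dl, 0 < dl &
    exists T, forall s t, T <= t -> t <= s <= (1 + dl) * t ->
    `|W s w - W t w| <= eps m * phi s}.
  have : {ae P, forall w, forall m, exists2 dl, 0 < dl &
    exists T, forall s t, T <= t -> t <= s <= (1 + dl) * t ->
    `|W s w - W t w| <= eps m * phi s} by exact/ae_foralln.
  apply: filterS => w Hw e e0.
  have [dl dl0 [T0 HT]] := Hw (Num.truncn e^-1).
  exists dl => //; exists T0 => s t Tt ts; apply: le_trans (HT s t Tt ts) _.
  apply: ler_wpM2r; first exact: phi_ge0.
  rewrite /eps -[leRHS]invrK lef_pV2 ?posrE ?invr_gt0// ltW//.
  exact: truncnS_gt.
have e0 : 0 < eps m by rewrite invr_gt0.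
(* The ratio [c = sqrt (1 + b)] is such that the interval from [c ^+ j] to
   [c ^+ j.+2] has length [b * c ^+ j]; it contains both [t] and [s]. *)
pose b := (eps m / 20) ^+ 2.
have b0 : 0 < b by rewrite exprn_gt0// divr_gt0.
pose c := Num.sqrt (1 + b).
have c1 : 1 < c by rewrite -[ltLHS]sqrtr1 /c ltr_sqrt; lra.
have c2 : c ^+ 2 = 1 + b by rewrite sqr_sqrtr// addr_ge0// ltW.
have c0 : 0 < c by exact: lt_trans c1.
have := oscillation_ae (tau := fun j => c ^+ j) (L := fun j => b * c ^+ j) hW c1
  (fun j => exprn_ge0 _ (ltW c0)) (fun j => mulr_gt0 b0 (exprn_gt0 _ c0)).
apply: filterS => w [N _ HN].
exists (c - 1); first by rewrite subr_gt0.
have [N' HN'] := geometric_ge_expR1 c1.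
exists (c ^+ (maxn N N')) => s t tN; rewrite addrC subrK => /andP[ts sct].
have t1 : 1 <= t by apply: le_trans tN; rewrite exprn_ege1// ltW.
have [j /andP[jt tj]] := geometric_bracket c1 t1.
have : (maxn N N' <= j)%N by have := le_lt_trans tN tj; rewrite ltr_eXn2l.
rewrite geq_max => /andP[Nj N'j].
have ej : expR 1 <= c ^+ j by apply: le_trans HN' _; rewrite ler_eXn2l.
have osc u : t <= u <= s -> `|W u w - W (c ^+ j) w| <= eps m / 2 * phi s.
  move=> /andP[tu us]; apply: (le_trans (HN j Nj u _)).
    rewrite (le_trans jt)//= -[X in X + _]mul1r -mulrDl -c2 expr2 -mulrA -exprS.
    by rewrite (le_trans us)// (le_trans sct)// ler_pM2l// ltW.
  rewrite -mulrA sqrtrM ?(ltW b0)// /b sqrtr_sqr ger0_norm ?divr_ge0 ?(ltW e0)//.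
  rewrite mulrA (_ : 10 * (eps m / 20) = eps m / 2); last by field.
  by rewrite ler_pM2l ?divr_gt0//; apply: le_phi => //; exact: le_trans ts.
have -> : W s w - W t w = (W s w - W (c ^+ j) w) - (W t w - W (c ^+ j) w) by ring.
apply: le_trans (ler_normB _ _) _.
have -> : eps m * phi s = eps m / 2 * phi s + eps m / 2 * phi s by field.
by apply: lerD; apply: osc; rewrite ?lexx ?andbT.
Qed.
End brownian_paths.

(** * Law of the iterated logarithm for finite sums of increments *)

Section finite_sums.
Context {R : realType}.

Lemma cauchy_schwarz_sum (n : nat) (x y : 'I_n -> R) :
  (\sum_(i < n) x i * y i) ^+ 2 <=
  (\sum_(i < n) x i ^+ 2) * (\sum_(i < n) y i ^+ 2).
Proof.
set A := \sum_(i < n) x i ^+ 2; set B := \sum_(i < n) y i ^+ 2.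
set C := \sum_(i < n) _.
have B0 : 0 <= B by apply: sumr_ge0 => i _; exact: sqr_ge0.
have : 0 <= \sum_(i < n) (B * x i - C * y i) ^+ 2.
  by apply: sumr_ge0 => i _; exact: sqr_ge0.
have -> : \sum_(i < n) (B * x i - C * y i) ^+ 2 = B * (A * B - C ^+ 2).
  transitivity (\sum_(i < n) (B ^+ 2 * x i ^+ 2 - 2 * B * C * (x i * y i) +
      C ^+ 2 * y i ^+ 2)).
    by apply: eq_bigr => i _; ring.
  rewrite big_split/= sumrB -!mulr_sumr -/A -/B -/C; ring.
move: B0; rewrite le_eqVlt => /orP[/eqP B0 _|B0]; last first.
  by rewrite pmulr_rge0// subr_ge0.
have y0 i : y i = 0.
  apply/eqP; rewrite -sqrf_eq0; apply/eqP.
  by have := psumr_eq0P (fun i _ => sqr_ge0 (y i)) (esym B0); apply.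
by rewrite /C big1 ?expr0n ?mulr_ge0 ?sumr_ge0//= => i _; rewrite ?y0 ?mulr0 ?sqr_ge0.
Qed.

Lemma lee_prod (I : Type) (s : seq I) (f g : I -> \bar R) :
  (forall i, (0 <= f i <= g i)%E) -> (\prod_(i <- s) f i <= \prod_(i <- s) g i)%E.
Proof.
move=> fg; suff /andP[] : (0 <= \prod_(i <- s) f i <= \prod_(i <- s) g i)%E by [].
elim/big_rec2 : _ => [|i x y _ /andP[x0 xy]]; first by rewrite lee01 lexx.
have /andP[fi0 fig] := fg i.
by rewrite mule_ge0//= lee_pmul.
Qed.

End finite_sums.

Section gaussian_ball.
Context {R : realType} {d : measure_display} {T : measurableType d}.
Variables (P : probability T R) (W : R -> {RV P >-> R}).
Hypothesis hW : standard_brownian_motion W.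

Lemma union_bound (I : Type) (s : seq I) (F : I -> set T) (p : R) :
  (forall i, measurable (F i)) -> (forall i, (P (F i) <= p%:E)%E) ->
  (P (\big[setU/set0]_(i <- s) F i) <= ((size s)%:R * p)%:E)%E.
Proof.
move=> mF Fp; elim: s => [|i s IH]; first by rewrite big_nil measure0 mul0r.
rewrite big_cons /= -natr1 mulrDl mul1r addrC EFinD.
apply: le_trans (measureU2 _ _ _) (leeD (Fp i) IH) => //.
exact: bigsetU_measurable.
Qed.

(** The complement of the ball is covered by finitely many boxes
   [{ |u_i| >= r_i * x }] with [r] on a grid of step [1 / K] and
   [\sum_i r_i ^ 2 >= 1 - e]; by independence each box has a probability at
   most [2 ^ n * expR (- (\sum_i r_i ^ 2) * x ^ 2 / 2)]. *)
Lemma gaussian_ball_prob (n : nat) (e : R) : 0 < e ->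
  exists2 C : R, 0 < C & forall (t : nat -> R) (x : R),
    0 <= t 0%N -> {homo t : i j / (i <= j)%N >-> i <= j} -> 0 < x ->
    exists E, [/\ measurable E, (P E <= (C * expR (- (1 - e) * x ^+ 2 / 2))%:E)%E &
      forall w, ~ E w -> \sum_(i < n) ninc W (t i) (t i.+1) w ^+ 2 <= x ^+ 2].
Proof.
move=> e0.
pose K := (Num.truncn (3 * n%:R / e)).+1.
have K0 : 0 < K%:R :> R by rewrite ltr0n.
have Kn : 3 * n%:R / K%:R <= e.
  by rewrite ler_pdivrMr// [leRHS]mulrC -ler_pdivrMr// ltW//; exact: truncnS_gt.
pose grid := [seq r : {ffun 'I_n -> 'I_K.+1} <- enum {ffun 'I_n -> 'I_K.+1} |
  1 - e <= \sum_(i < n) ((r i : nat)%:R / K%:R) ^+ 2].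
exists ((size grid).+1%:R * 2 ^+ n); first by rewrite mulr_gt0// exprn_gt0.
move=> t x t0 tmono x0.
pose u i w := ninc W (t i) (t i.+1) w.
have tS i : 0 <= t i /\ t i <= t i.+1.
  by split; [rewrite (le_trans t0)// tmono|rewrite tmono].
pose F (r : {ffun 'I_n -> 'I_K.+1}) :=
  \big[setI/setT]_(i < n) [set w | (r i : nat)%:R / K%:R * x <= `|u i w|].
pose r' (r : {ffun 'I_n -> 'I_K.+1}) (i : nat) : R :=
  if insub i is Some j then (r j : nat)%:R / K%:R * x else 0.
have r'E r (i : 'I_n) : r' r i = (r i : nat)%:R / K%:R * x by rewrite /r' valK.
have mF r : measurable (F r).
  apply: big_ind => //; first exact: measurableI.
  by move=> i _; exact: measurable_ninc_preimage (measurable_norm_ge _).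
have PF (r : {ffun 'I_n -> 'I_K.+1}) : 1 - e <= \sum_(i < n) ((r i : nat)%:R / K%:R) ^+ 2 ->
    (P (F r) <= (2 ^+ n * expR (- (1 - e) * x ^+ 2 / 2))%:E)%E.
  move=> re.
  have -> : F r = \big[setI/setT]_(i < n) [set w | [set y | r' r i <= `|y|] (u i w)].
    by apply: eq_bigr => i _; rewrite /= r'E.
  rewrite (ninc_indep hW n (B := fun i => [set y | r' r i <= `|y|]) t0 tmono); last by move=> i; exact: measurable_norm_ge.
  apply: (@le_trans _ _ (\prod_(i < n) (2 * expR (- r' r i ^+ 2 / 2))%:E)%E).
    apply: lee_prod => i; rewrite measure_ge0/=.
    by apply: (ninc_tail hW) => //; [case: (tS i)..|rewrite r'E mulr_ge0 ?divr_ge0 ?(ltW x0)].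
  rewrite prodEFin lee_fin big_split/= prodr_const card_ord.
  rewrite ler_pM2l ?exprn_gt0// -expR_sum ler_expR.
  rewrite (eq_bigr (fun i : 'I_n => ((r i : nat)%:R / K%:R) ^+ 2 * (- x ^+ 2 / 2))); last first.
    by move=> i _; rewrite r'E exprMn; set a := _ / _; field.
  rewrite -mulr_suml; have : 0 <= x ^+ 2 / 2 by rewrite divr_ge0// sqr_ge0.
  move: re; set S := \sum_(i < n) _; rewrite !mulNr.
  by set z := x ^+ 2; nra.
exists (\big[setU/set0]_(r <- grid) F r); split.
- exact: bigsetU_measurable.
- apply: (@le_trans _ _ ((size grid)%:R * (2 ^+ n * expR (- (1 - e) * x ^+ 2 / 2)))%:E).
    pose F' (r : {ffun 'I_n -> 'I_K.+1}) :=
      if 1 - e <= \sum_(i < n) ((r i : nat)%:R / K%:R) ^+ 2 then F r else set0.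
    have -> : \big[setU/set0]_(r <- grid) F r = \big[setU/set0]_(r <- grid) F' r.
      by rewrite /grid !big_filter; apply: eq_bigr => r h; rewrite /F' h.
    apply: union_bound => r; rewrite /F'; case: ifP => h; [exact: mF|by []|exact: PF|].
    by rewrite measure0 lee_fin mulr_ge0 ?exprn_ge0 ?expR_ge0.
  rewrite lee_fin mulrA ler_wpM2r ?expR_ge0// ler_wpM2r ?exprn_ge0// ler_nat.
  exact: leqnSn.
- move=> w nE; rewrite leNgt; apply/negP => xu; apply: nE.
  pose r : {ffun 'I_n -> 'I_K.+1} := [ffun i : 'I_n => inord (minn (Num.truncn (K%:R * `|u i w| / x)) K)].
  have rE (i : 'I_n) : (r i : nat) = minn (Num.truncn (K%:R * `|u i w| / x)) K.
    by rewrite ffunE inordK// ltnS geq_minr.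
  have q0 i : 0 <= K%:R * `|u i w| / x by rewrite divr_ge0 ?mulr_ge0 ?(ltW x0)//.
  have Fr : F r w.
    rewrite /F -bigcap_seq => i _ /=.
    rewrite rE mulrAC ler_pdivrMr// -ler_pdivlMr// [`|_| * _]mulrC.
    apply: (@le_trans _ _ (Num.truncn (K%:R * `|u i w| / x))%:R).
      by rewrite ler_nat geq_minl.
    by have /andP[] := truncn_itv (q0 i).
  have rg : r \in grid.
    rewrite mem_filter mem_enum andbT.
    have [[i iK]|allK] := pselect (exists i, (r i : nat) = K).
      rewrite (bigD1 i)//= iK divff ?gt_eqF// expr1n -subr_ge0.
      by rewrite opprD opprK addrA [1 + _]addrC addrK addr_ge0 ?(ltW e0)// sumr_ge0// => *; exact: sqr_ge0.
    have ub (i : 'I_n) : u i w ^+ 2 <= x ^+ 2 * (((r i : nat)%:R / K%:R) ^+ 2 + 3 / K%:R).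
      have iK : (Num.truncn (K%:R * `|u i w| / x) < K)%N.
        rewrite ltnNge; apply/negP => h; apply: allK; exists i.
        by rewrite rE; apply/minn_idPr.
      have ri : (r i : nat) = Num.truncn (K%:R * `|u i w| / x).
        by rewrite rE; apply/minn_idPl; exact: ltnW.
      have /andP[_] := truncn_itv (q0 i); rewrite -ri ltr_pdivrMr// => h.
      have rK : (r i : nat)%:R <= K%:R :> R by rewrite ler_nat ri ltnW.
      have K1 : 1 <= K%:R :> R by rewrite ler1n.
      rewrite -(ler_pM2l (exprn_gt0 2 K0)) -[u i w ^+ 2]real_normK ?num_real//.
      apply: (@le_trans _ _ ((((r i : nat)%:R + 1) * x) ^+ 2)).
        rewrite -exprMn ler_sqr ?nnegrE ?mulr_ge0 ?addr_ge0 ?(ltW x0)//.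
        by rewrite natr1 ltW.
      have -> : K%:R ^+ 2 * (x ^+ 2 * (((r i : nat)%:R / K%:R) ^+ 2 + 3 / K%:R)) =
          x ^+ 2 * ((r i : nat)%:R ^+ 2 + 3 * K%:R).
        by field; rewrite gt_eqF.
      rewrite exprMn mulrC ler_pM2l ?exprn_gt0// sqrrD1.
      by move: rK K1; set a := (r i : nat)%:R; set b := K%:R; lra.
    have := lt_le_trans xu (ler_sum _ (fun i _ => ub i)).
    rewrite -mulr_sumr big_split/= sumr_const card_ord -[_ *+ n]mulr_natr.
    rewrite -{1}[x ^+ 2]mulr1 ltr_pM2l ?exprn_gt0//.
    have -> : 3 / K%:R * n%:R = 3 * n%:R / K%:R :> R by rewrite mulrAC.
    by move: Kn; set S := \sum_(i < n) _; set z := _ / _; lra.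
  by rewrite -bigcup_seq; exists r.
Qed.
End gaussian_ball.

Section iterated_logarithm.
Context {R : realType} {d : measure_display} {T : measurableType d}.
Variables (P : probability T R) (W : R -> {RV P >-> R}).
Hypothesis hW : standard_brownian_motion W.
Variables (n : nat) (g co : nat -> R).
Hypotheses (g0 : 0 <= g 0%N) (gmono : {homo g : i j / (i <= j)%N >-> i <= j}).

Definition inc_sum (t : R) (w : T) : R :=
  \sum_(i < n) co i * (W (t * g i.+1) w - W (t * g i) w).

Definition inc_var : R := \sum_(i < n) co i ^+ 2 * (g i.+1 - g i).

Let tgmono t : 0 <= t -> {homo (fun i => t * g i) : i j / (i <= j)%N >-> i <= j}.
Proof. by move=> t0 i j ij; rewrite ler_wpM2l// gmono. Qed.

Lemma inc_sumE t w : 0 <= t -> inc_sum t w =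
  \sum_(i < n) (co i * Num.sqrt (t * (g i.+1 - g i))) * ninc W (t * g i) (t * g i.+1) w.
Proof.
move=> t0; apply: eq_bigr => i _; rewrite nincE ?tgmono// mulrBr.
by rewrite mulrA.
Qed.

(** By the Cauchy-Schwarz inequality, the weighted sum of increments exceeds
   its threshold only if the vector of normalized increments leaves a ball. *)
Lemma inc_sum_limsup_le (c e : R) : 1 < c -> 0 < e ->
  {ae P, forall w, \forall j \near \oo,
    `|inc_sum (c ^+ j) w| <= (1 + e) * Num.sqrt (2 * inc_var) * phi (c ^+ j)}.
Proof.
move=> c1 e0.
have e1 : 0 < 1 + e by rewrite addr_gt0.
have e'0 : 0 < e / (1 + e) by rewrite divr_gt0.
have [C C0 HC] := gaussian_ball_prob hW n e'0.
have c0 : 0 < c by exact: lt_trans c1.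
pose x j : R := Num.max 1 ((1 + e) * Num.sqrt (2 * ln (ln (c ^+ j)))).
have x0 j : 0 < x j by rewrite lt_max ltr01.
have tg0 j : 0 <= c ^+ j * g 0%N by rewrite mulr_ge0// exprn_ge0// ltW.
have /choice[E HE] := fun j => HC (fun i => c ^+ j * g i) (x j) (tg0 j)
  (tgmono (exprn_ge0 j (ltW c0))) (x0 j).
have nx : \forall j \near \oo, x j = (1 + e) * Num.sqrt (2 * ln (ln (c ^+ j))) /\
    0 <= ln (ln (c ^+ j)).
  have lnlny := @lnln_cvgX R c c1.
  near=> j; split; last by near: j; move/cvgryPge : lnlny; apply.
  apply/max_idPr; rewrite -[leLHS]mulr1; apply: ler_pM => //.
    by rewrite lerDl ltW.
  rewrite -[leLHS]sqrtr1; apply: ler_wsqrtr.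
  by rewrite -ler_pdivrMl//; near: j; move/cvgryPge : lnlny; apply.
have [B HB] := @lnln_sum_bounded R c (1 + e) c1 (eq_ind _ is_true e0 _ (esym (ltrDl 1 e))).
have uB m : \sum_(0 <= k < m) (C * expR (- (1 + e) * ln (ln (c ^+ k)))) <= C * B.
  by rewrite -mulr_sumr ler_pM2l.
have u0 k : 0 <= C * expR (- (1 + e) * ln (ln (c ^+ k))).
  by rewrite mulr_ge0 ?expR_ge0// ltW.
have : {ae P, forall w, \forall k \near \oo, ~ E k w}.
  apply: (eventually_notin _ u0 uB); first by move=> k; case: (HE k).
  near=> k; have [_ + _] := HE k.
  have [-> l0] : x k = (1 + e) * Num.sqrt (2 * ln (ln (c ^+ k))) /\ 0 <= ln (ln (c ^+ k)).
    by near: k.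
  rewrite exprMn sqr_sqrtr ?mulr_ge0// => /le_trans; apply.
  rewrite lee_fin ler_pM2l// ler_expR le_eqVlt; apply/orP; left; apply/eqP.
  by field; rewrite gt_eqF.
apply: filterS => w nE; near=> j.
have [_ _ H] := HE j.
have nEj : ~ E j w by near: j.
have [xE l0] : x j = (1 + e) * Num.sqrt (2 * ln (ln (c ^+ j))) /\ 0 <= ln (ln (c ^+ j)).
  by near: j.
have t0 : 0 <= c ^+ j by rewrite exprn_ge0// ltW.
have {H nEj} := H w nEj => H.
rewrite inc_sumE// -[leRHS]ger0_norm; last first.
  by rewrite mulr_ge0 ?sqrtr_ge0// mulr_ge0 ?sqrtr_ge0// ltW.
rewrite -ler_sqr ?nnegrE// !real_normK ?num_real//.
apply: le_trans (cauchy_schwarz_sum _ _) _.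
have -> : \sum_(i < n) (co i * Num.sqrt (c ^+ j * (g i.+1 - g i))) ^+ 2 = c ^+ j * inc_var.
  rewrite /inc_var mulr_sumr; apply: eq_bigr => i _.
  by rewrite exprMn sqr_sqrtr ?mulr_ge0 ?subr_ge0 ?gmono//; ring.
have V0 : 0 <= inc_var.
  by apply: sumr_ge0 => i _; rewrite mulr_ge0 ?sqr_ge0// subr_ge0 gmono.
apply: le_trans (ler_wpM2l (mulr_ge0 t0 V0) H) _.
rewrite xE !exprMn !sqr_sqrtr ?mulr_ge0//.
by rewrite le_eqVlt; apply/orP; left; apply/eqP; ring.
Unshelve. all: by end_near. Qed.

End iterated_logarithm.

Section iterated_logarithm_lower.
Context {R : realType} {d : measure_display} {T : measurableType d}.
Variables (P : probability T R) (W : R -> {RV P >-> R}).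
Hypothesis hW : standard_brownian_motion W.
Variables (n : nat) (g co : nat -> R) (c : R).
Hypotheses (n0 : (0 < n)%N) (c1 : 1 < c) (g0 : g 0%N = c^-1) (gn : g n = 1)
  (gmono : {homo g : i j / (i <= j)%N >-> i <= j}) (co0 : forall i, 0 <= co i).

Local Notation V := (inc_var n g co).
Hypothesis V0 : 0 < V.

Let tau m := c ^+ (m %/ n).+1 * g (m %% n)%N.

Let c0 : 0 < c. Proof. exact: lt_trans c1. Qed.

Let tauE j i : (i <= n)%N -> tau (j * n + i) = c ^+ j.+1 * g i.
Proof.
rewrite leq_eqVlt => /orP[/eqP ->|i_n].
  rewrite /tau -mulSnr mulnK// modnMl g0 gn mulr1 exprS mulrAC divff ?mul1r//.
  by rewrite gt_eqF.
by rewrite /tau divnMDl// divn_small// addn0 modnMDl modn_small.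
Qed.

Let tau0 : 0 <= tau 0%N.
Proof. by rewrite /tau mod0n g0 mulr_ge0 ?invr_ge0 ?exprn_ge0// ltW. Qed.

Let tau_mono : {homo tau : i j / (i <= j)%N >-> i <= j}.
Proof.
apply: homo_leq => //; first exact: le_trans.
move=> m; rewrite (divn_eq m n) -addnS !tauE ?ltn_pmod//; last exact/ltnW/ltn_pmod.
by rewrite ler_wpM2l ?gmono// exprn_ge0// ltW.
Qed.

Lemma harmonic_tail_unbounded (K : R) (m : nat) (B : R) : 0 < K ->
  exists k, B <= \sum_(j <- iota m k) K / j.+1%:R.
Proof.
move=> K0.
have H k : ln (m + k).+1%:R - ln m.+1%:R <= \sum_(j <- iota m k) j.+1%:R^-1 :> R.
  elim: k => [|k IH]; first by rewrite addn0 subrr big_nil.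
  rewrite -[k.+1]addn1 iotaD big_cat/= big_seq1.
  apply: le_trans (lerD IH (lexx _)).
  have a0 : 0 < (m + k).+1%:R :> R by rewrite ltr0n.
  have -> : (m + (k + 1)).+1%:R = (m + k).+1%:R * (1 + (m + k).+1%:R^-1) :> R.
    by rewrite addn1 addnS -natr1; field; rewrite gt_eqF.
  rewrite lnM ?posrE// ?addr_gt0 ?invr_gt0//.
  have := @le_ln1Dx R (m + k).+1%:R^-1.
  have i0 : -1 < (m + k).+1%:R^-1 :> R by rewrite (lt_trans _ (_ : 0 < _)) ?invr_gt0// ltrN10.
  move=> /(_ i0); set a := _^-1; set l := ln (1 + a); set l2 := ln _; set l3 := ln _; lra.
pose N := Num.truncn (expR (B / K + ln m.+1%:R)).
exists N; rewrite -mulr_sumr mulrC -ler_pdivrMr//; apply: le_trans (H N).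
rewrite lerBrDr -[leLHS]expRK ler_ln ?posrE ?expR_gt0 ?ltr0n//.
apply: (@le_trans _ _ N.+1%:R); first exact: ltW (truncnS_gt _).
by rewrite ler_nat ltnS leq_addl.
Qed.

(** The rectangle in which every increment reaches its share, prescribed by the
   equality case of the Cauchy-Schwarz inequality, of the threshold has the same
   exponential cost as the event that the weighted sum reaches it. *)
Lemma inc_sum_limsup_ge (e : R) : 0 < e < 1 ->
  {ae P, forall w, forall m, exists2 j, (m <= j)%N &
    (1 - e) * Num.sqrt (2 * V) * phi (c ^+ j.+1) <= inc_sum W n g co (c ^+ j.+1) w}.
Proof.
move=> /andP[e0 e1].
have gS i : 0 <= g i.+1 - g i by rewrite subr_ge0 gmono.
pose z j i : R := (1 - e) * Num.sqrt (2 * ln (ln (c ^+ j.+1))) *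
  (co i * Num.sqrt (g i.+1 - g i) / Num.sqrt V).
have z0 j i : 0 <= z j i.
  by rewrite !mulr_ge0 ?sqrtr_ge0 ?subr_ge0 ?(ltW e1)// ?invr_ge0 ?sqrtr_ge0.
pose B m := [set y : R | z (m %/ n)%N (m %% n)%N <= y].
have mB m : measurable (B m) by exact: measurable_ge.
pose A := block_event W tau B n.
have incE j (i : 'I_n) : inc_event W tau B (j * n + i) =
    [set w | z j i <= ninc W (c ^+ j.+1 * g i) (c ^+ j.+1 * g i.+1) w].
  rewrite /inc_event -addnS !tauE// ?(ltnW (ltn_ord i))// /B.
  by rewrite divnMDl// modnMDl divn_small// modn_small// addn0.
pose p j := fine (P (A j)).
have mA j : measurable (A j) by exact: measurable_block_event.
have pE j : P (A j) = (p j)%:E by rewrite /p fineK// fin_num_measure.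
have p0 j : 0 <= p j by rewrite /p fine_ge0.
have p1 j : p j <= 1 by rewrite -lee_fin -pE probability_le1.
have prod_rule s : uniq s -> P (\big[setI/setT]_(j <- s) A j) = (\prod_(j <- s) p j)%:E.
  move=> us; rewrite (block_event_product_rule hW)// -prodEFin.
  by apply: eq_bigr => j _; rewrite pE.
have [N HN] := geometric_ge_expR1 c1.
pose K := gauss_const ^+ n * expR (- (1 + e^-1) / 2) ^+ n / ln c : R.
have K0 : 0 < K.
  by rewrite !mulr_gt0 ?exprn_gt0 ?expR_gt0 ?gauss_const_gt0// invr_gt0 ln_gt0.
have ll0 j : (N <= j)%N -> 0 <= ln (ln (c ^+ j.+1)).
  by move=> Nj; apply: lnln_ge0; apply: le_trans HN _; rewrite ler_eXn2l// leqW.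
have z2 j : (N <= j)%N -> \sum_(i < n) z j i ^+ 2 = (1 - e) ^+ 2 * (2 * ln (ln (c ^+ j.+1))).
  move=> Nj.
  under eq_bigr do rewrite /z 4!exprMn exprVn !sqr_sqrtr ?(ltW V0) ?mulr_ge0 ?ll0//.
  by rewrite -mulr_sumr -mulr_suml -/V divff ?mulr1// gt_eqF.
have pK j : (N <= j)%N -> K / j.+1%:R <= p j.
  move=> Nj; rewrite -lee_fin -pE (P_block_event hW)//.
  have step (i : 'I_n) : ((gauss_const * expR (- (z j i + 1) ^+ 2 / 2))%:E <=
      P (inc_event W tau B (j * n + i)))%E.
    rewrite incE; apply: (ninc_tail_lower hW) => //.
      by rewrite mulr_ge0 ?exprn_ge0 ?(ltW c0)// (le_trans _ (gmono (leq0n i)))// g0 invr_ge0 ltW.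
    have := gS i; rewrite subr_ge0 le_eqVlt => /orP[/eqP gi|gi]; [right|left].
      by rewrite -gi; split => //; rewrite /z -gi subrr sqrtr0 mulr0 mul0r mulr0.
    by rewrite ltr_pM2l// exprn_gt0.
  apply: (@le_trans _ _ (\prod_(i < n) (gauss_const * expR (- (z j i + 1) ^+ 2 / 2))%:E)%E).
    rewrite prodEFin lee_fin big_split/= prodr_const card_ord -expR_sum.
    have -> : K / j.+1%:R = gauss_const ^+ n *
        expR (- (1 + e^-1) / 2 * n%:R - ln (ln (c ^+ j.+1))).
      rewrite /K lnlnX// expRB expRD !lnK ?posrE ?ltr0n ?ln_gt0// expRM_natr.
      by rewrite invfM !mulrA.
    rewrite ler_wpM2l ?exprn_ge0 ?(ltW gauss_const_gt0)// ler_expR.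
    apply: (@le_trans _ _ (\sum_(i < n) (- (1 + e^-1) / 2 - (1 + e) / 2 * z j i ^+ 2))).
      rewrite sumrB sumr_const card_ord -mulr_sumr z2// -[X in _ <= X - _]mulr_natr lerD2l lerN2.
      have := ll0 j Nj; set l := ln _ => l0.
      have -> : (1 + e) / 2 * ((1 - e) ^+ 2 * (2 * l)) = (1 - e * (1 + e - e ^+ 2)) * l by field.
      rewrite ler_piMl// gerBl mulr_ge0 ?(ltW e0)//; nra.
    apply: ler_sum => i _; rewrite -subr_ge0.
    have -> : - (z j i + 1) ^+ 2 / 2 - (- (1 + e^-1) / 2 - (1 + e) / 2 * z j i ^+ 2) =
        (e * z j i - 1) ^+ 2 / (2 * e).
      by field; rewrite gt_eqF.
    by rewrite divr_ge0 ?sqr_ge0// mulr_ge0// ltW.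
  apply: lee_prod => i; rewrite step andbT lee_fin mulr_ge0 ?expR_ge0//.
  exact: ltW gauss_const_gt0.
have pB m C : exists k, C <= \sum_(j <- iota m k) p j.
  have [k Hk] := harmonic_tail_unbounded (m + N) C K0.
  exists (N + k)%N; rewrite iotaD big_cat/=; apply: (le_trans Hk).
  apply: (@le_trans _ _ (\sum_(j <- iota (m + N) k) p j)).
    rewrite big_seq [leRHS]big_seq; apply: ler_sum => j; rewrite mem_iota => /andP[h _].
    by apply: pK; rewrite (leq_trans _ h)// leq_addl.
  by rewrite lerDr sumr_ge0.
have := product_rule_infinitely_often mA prod_rule p1 pB.
apply: filterS => w Hw m.
have [j mj Aj] := Hw (maxn m N).
move: mj; rewrite geq_max => /andP[mj Nj]; exists j => //.
have t0 : 0 <= c ^+ j.+1 by rewrite exprn_ge0// ltW.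
rewrite inc_sumE//.
have zi (i : 'I_n) : z j i <= ninc W (c ^+ j.+1 * g i) (c ^+ j.+1 * g i.+1) w.
  have : inc_event W tau B (j * n + i) w.
    by move: Aj; rewrite /A /block_event -(bigcap_mkord n (fun i => inc_event W tau B (j * n + i))) => /(_ i (ltn_ord i)).
  by rewrite incE.
apply: (@le_trans _ _ (\sum_(i < n) (co i * Num.sqrt (c ^+ j.+1 * (g i.+1 - g i))) * z j i)).
  have -> : \sum_(i < n) co i * Num.sqrt (c ^+ j.+1 * (g i.+1 - g i)) * z j i =
     (1 - e) * Num.sqrt (2 * ln (ln (c ^+ j.+1))) * Num.sqrt (c ^+ j.+1) / Num.sqrt V * V.
    rewrite {2}/inc_var mulr_sumr; apply: eq_bigr => i _.
    rewrite sqrtrM// /z -[in RHS](sqr_sqrtr (gS i)); ring.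
  rewrite -[X in _ <= _ * X](sqr_sqrtr (ltW V0)) expr2 mulrA divfK; last first.
    by rewrite gt_eqF// sqrtr_gt0.
  rewrite /phi mulrC !sqrtrM ?ll0//.
  by rewrite le_eqVlt; apply/orP; left; apply/eqP; ring.
apply: ler_sum => i _; apply: ler_wpM2l; last exact: zi.
by rewrite mulr_ge0// sqrtr_ge0.
Qed.

End iterated_logarithm_lower.

(** * Regularly varying sequences *)

Section truncn_ratio.
Context {R : realType}.

Lemma truncn_ratio_cvg (lam : R) : 0 < lam ->
  (Num.truncn (lam * n%:R))%:R / n%:R @[n --> \oo] --> lam.
Proof.
move=> l0; apply/cvgrPdist_le => e e0; near=> n.
have n0 : 0 < n%:R :> R by rewrite ltr0n; near: n; exists 1%N.
have ln0 : 0 <= lam * n%:R by rewrite mulr_ge0// ltW.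
have /andP[t1 t2] := truncn_itv ln0.
have -> : lam - (Num.truncn (lam * n%:R))%:R / n%:R =
    (lam * n%:R - (Num.truncn (lam * n%:R))%:R) / n%:R by field; rewrite gt_eqF.
rewrite ger0_norm ?divr_ge0 ?subr_ge0 ?(ltW n0)// ler_pdivrMr//.
apply: (@le_trans _ _ 1); first by rewrite lerBlDl natr1 ltW.
rewrite mulrC -ler_pdivrMr// mul1r.
by near: n; exact: nbhs_infty_ger.
Unshelve. all: by end_near. Qed.

Lemma truncn_cvg (lam : R) : 0 < lam ->
  forall N, \forall n \near \oo, (N <= Num.truncn (lam * n%:R))%N.
Proof.
move=> l0 N; near=> n.
rewrite truncn_ge_nat; last by rewrite mulr_ge0// ltW.
by rewrite mulrC -ler_pdivrMr//; near: n; exact: nbhs_infty_ger.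
Unshelve. all: by end_near. Qed.

Lemma powR_difference_cvg (p : R) :
  n.+1%:R * (1 - (n%:R / n.+1%:R) `^ p) @[n --> \oo] --> p.
Proof.
have d1 : (1 : R) \in `]0, +oo[ by rewrite in_itv/= ltr01.
have dE : 'D_1 (@powR R ^~ p) 1 = p.
  by rewrite -derive1E powR_derive1// powR1 mulr1.
have /cvg_ex[l hl] := @derivable_powR R 1 p 1 d1.
have lp : l = p by rewrite -dE; apply/esym/cvg_lim.
rewrite lp in hl.
have /cvgr_dnbhsP/(_ (fun n => - n.+1%:R^-1)) := hl.
have u0 : (forall n, - n.+1%:R^-1 != 0 :> R) /\ - n.+1%:R^-1 @[n --> \oo] --> (0 : R).
  split=> [n|]; first by rewrite oppr_eq0 invr_eq0 pnatr_eq0.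
  by rewrite -oppr0; apply: cvgN; exact: cvg_harmonic.
move=> /(_ u0); apply: cvg_trans; apply: near_eq_cvg; near=> n.
rewrite /= /GRing.scale /= mulr1 powR1 invrN invrK mulNr -mulrN opprB.
congr (_ * (1 - _ `^ p)); rewrite -natr1; field.
by rewrite natr1 gt_eqF.
Unshelve. all: by end_near. Qed.
End truncn_ratio.

Section weighted_cesaro.
Context {R : realType}.

Lemma weighted_cesaro (x y : nat -> R) (l : R) : (forall k, 0 < y k) ->
  \sum_(0 <= k < n) y k @[n --> \oo] --> +oo ->
  x k / y k @[k --> \oo] --> l ->
  (\sum_(0 <= k < n) x k) / (\sum_(0 <= k < n) y k) @[n --> \oo] --> l.
Proof.
move=> y0 /cvgryPge Yoo /cvgrPdist_le xy; apply/cvgrPdist_le => e e0.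
have e20 : 0 < e / 2 by rewrite divr_gt0.
have [N _ HN] := xy _ e20.
pose C := \sum_(0 <= k < N) `|x k - l * y k|.
have C0 : 0 <= C by rewrite sumr_ge0.
near=> n.
have Nn : (N <= n)%N by near: n; exists N.
have CY : C / (e / 2) <= \sum_(0 <= k < n) y k by near: n; exact: Yoo.
have Y0 : 0 < \sum_(0 <= k < n) y k.
  by rewrite (@lt_le_trans _ _ 1)//; near: n; exact: Yoo.
rewrite distrC; set X := \sum_(0 <= k < n) x k; set Y := \sum_(0 <= k < n) y k.
have -> : X / Y - l = (X - l * Y) / Y by field; rewrite gt_eqF.
rewrite normrM normfV (gtr0_norm Y0) ler_pdivrMr//.
have -> : X - l * Y = \sum_(0 <= k < n) (x k - l * y k) by rewrite sumrB -mulr_sumr.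
apply: le_trans (ler_norm_sum _ _ _) _.
rewrite (big_cat_nat (n := N))//= -/C.
have -> : e * Y = e / 2 * Y + e / 2 * Y by field.
apply: lerD; first by rewrite mulrC -ler_pdivrMr.
rewrite /Y [in leRHS](big_cat_nat (n := N))//= mulrDr ler_wpDl//.
  by rewrite mulr_ge0 ?sumr_ge0 ?(ltW e20)// => *; exact: ltW.
rewrite mulr_sumr; apply: ler_sum_nat => k /andP[Nk _].
have := HN k Nk; rewrite /= distrC.
have -> : x k / y k - l = (x k - l * y k) / y k by field; rewrite gt_eqF.
by rewrite normrM normfV (gtr0_norm (y0 k)) ler_pdivrMr.
Unshelve. all: by end_near. Qed.
End weighted_cesaro.

Section uniform_convergence.
Context {R : realType}.
Variable h : nat -> R.
Hypothesis h_cvg : forall lam : R, 0 < lam ->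
  h (Num.truncn (lam * n%:R)) - h n @[n --> \oo] --> 0.

Local Notation mu := (@lebesgue_measure R).

Let J (m l : nat) : set R := `[l%:R / m.+1%:R, l.+1%:R / m.+1%:R[%classic.

Let J_truncn (m l : nat) (x : R) : J m l x -> Num.truncn (x * m.+1%:R) = l.
Proof.
rewrite /J /= in_itv/= => /andP[h1 h2]; apply: truncn_def.
by rewrite -ler_pdivrMr// h1 -ltr_pdivlMr.
Qed.

Let mJ m l : measurable (J m l). Proof. exact: measurable_itv. Qed.

Let mu_J (m : nat) (s : seq nat) : uniq s ->
  mu (\big[setU/set0]_(l <- s) J m l) = ((size s)%:R / m.+1%:R)%:E.
Proof.
elim: s => [|l s IH]; first by rewrite big_nil measure0 mul0r.
move=> /= /andP[ls us]; rewrite big_cons.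
rewrite measureU; [|exact: mJ|by apply: bigsetU_measurable => i _; exact: mJ|]; last first.
  apply/seteqP; split => // x [Jl]; rewrite -bigcup_seq => -[k /= ks Jk].
  by move: ls; rewrite -(J_truncn Jl) (J_truncn Jk) ks.
have E1 : mu (J m l) = (m.+1%:R^-1)%:E.
  rewrite /J lebesgue_measure_itv/= lte_fin ltr_pM2r ?invr_gt0// ltr_nat ltnSn.
  by rewrite -EFinB -mulrBl -natr1 addrAC subrr add0r mul1r.
transitivity ((m.+1%:R^-1 : R)%:E + ((size s)%:R / m.+1%:R)%:E)%E.
  by congr (_ + _)%E; [exact: E1|exact: IH].
by rewrite -EFinD -[X in X + _]mul1r -mulrDl addrC natr1.
Qed.

Let bad (e : R) (m l : nat) := e < `|h l - h m.+1|.

(* the points [x] of [1, 4] whose index [truncn (x * m.+1)] is bad for [m.+1] *)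
Let F (e : R) (m : nat) : set R :=
  `[1, 4]%classic `&` \bigcup_(l in [set l | bad e m l]) J m l.

Let mF e m : measurable (F e m).
Proof.
apply: measurableI; first exact: measurable_itv.
exact: bigcup_measurable.
Qed.

Let mu_F_cvg e : 0 < e -> \forall m \near \oo, (mu (F e m) < (1 / 2)%:E)%E.
Proof.
move=> e0.
pose E m := \bigcup_(k in [set k | (m <= k)%N]) F e k.
have mE m : measurable (E m) by apply: bigcup_measurable.
have E14 m : E m `<=` `[1, 4]%classic by move=> x [k _ []].
have muI : mu (`[1, 4]%classic : set R) = 3%:E.
  rewrite lebesgue_measure_itv/= lte_fin ltr1n -EFinB; congr EFin; ring.
have Ecap : \bigcap_m E m = set0.
  apply/seteqP; split => // x Ex.
  have [_ _ [x14 _]] := Ex 0%N I.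
  have x0 : 0 < x by move: x14; rewrite /= in_itv/= => /andP[x1 _]; exact: lt_le_trans x1.
  have /cvgrPdist_le/(_ e e0)[N _ HN] := h_cvg x0.
  have [k /= Nk [_ [l bl Jl]]] := Ex N I.
  have := HN k.+1 (leqW Nk); rewrite /= sub0r normrN (J_truncn Jl).
  by rewrite leNgt; move: bl; rewrite /= /bad => ->.
have : mu (E m) @[m --> \oo] --> mu (\bigcap_m E m).
  apply: nonincreasing_cvg_mu => //.
  - apply: (@le_lt_trans _ _ (mu (`[1, 4]%classic : set R))).
      by apply: le_measure; rewrite ?inE; [exact: mE|exact: measurable_itv|exact: E14].
    by rewrite muI ltry.
  - exact: bigcapT_measurable.
  - move=> m k mk; apply/subsetPset => x [i /= ki Fi]; exists i => //=.
    exact: leq_trans ki.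
rewrite Ecap measure0 => /fine_cvgP[Efin /cvgrPdist_lt/(_ (1 / 2))].
have h0 : 0 < 1 / 2 :> R by rewrite divr_gt0.
move=> /(_ h0) E2.
near=> m; apply: (@le_lt_trans _ _ (mu (E m))).
  apply: le_measure; rewrite ?inE; [exact: mF|exact: mE|].
  by move=> x Fx; exists m => /=.
have Em : mu (E m) \is a fin_num by near: m.
rewrite -(fineK Em) lte_fin.
have : `|0 - fine (mu (E m))| < 1 / 2 by near: m.
by rewrite sub0r normrN; exact/le_lt_trans/ler_norm.
Unshelve. all: by end_near. Qed.

(** Uniform convergence theorem. The points [x] of [1, 4] at which
   [h (truncn (x * n)) - h n] is not small form a set of small measure, and each
   bad value [l] of [truncn (x * n)] contributes [1 / n] to it. So most [l] in
   [2n, 4n) are good for [n], and most are good for [k]; any [l] that is good for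
   both links [h n] to [h k]. *)
Lemma uniform_of_pointwise (e : R) : 0 < e ->
  \forall n \near \oo, forall k, (n <= k <= n.*2)%N -> `|h k - h n| <= e.
Proof.
move=> e0; have e20 : 0 < e / 2 by rewrite divr_gt0.
have [N _ HN] := mu_F_cvg e20.
exists N.+1 => // -[//|n] /= Nn k /andP[nk k2n].
case: k nk k2n => // k nk k2n.
have [[l [ln lk]]|nol] := pselect (exists l, ~ bad (e / 2) n l /\ ~ bad (e / 2) k l).
  move/negP : ln; rewrite /bad -leNgt => ln; move/negP : lk; rewrite /bad -leNgt => lk.
  have -> : h k.+1 - h n.+1 = (h l - h n.+1) - (h l - h k.+1) by ring.
  by apply: le_trans (ler_normB _ _) _; have := lerD ln lk; rewrite -splitr.
exfalso.
have cnt (m : nat) (s := [seq l <- iota n.+1.*2 n.+1.*2 | bad (e / 2) m l]) :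
    (n <= m)%N -> (m.+1 <= n.+1.*2)%N -> (size s)%:R / m.+1%:R < 1 / 2 :> R.
  move=> nm mn; rewrite -lte_fin -mu_J; last by rewrite filter_uniq// iota_uniq.
  apply: le_lt_trans (HN m _); last by rewrite /= (leq_trans _ nm).
  apply: le_measure; rewrite ?inE; [by apply: bigsetU_measurable => i _; exact: mJ|exact: mF|].
  move=> x; rewrite -bigcup_seq => -[l /=]; rewrite mem_filter mem_iota => /andP[bl /andP[l1 l2]] Jl.
  split; last by exists l.
  move: Jl; rewrite /J /= !in_itv/= => /andP[x1 /ltW x2]; apply/andP; split.
    apply: le_trans x1; rewrite ler_pdivlMr// mul1r ler_nat.
    by rewrite (leq_trans mn).
  apply: (le_trans x2); rewrite ler_pdivrMr// -natrM ler_nat.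
  by rewrite (leq_trans l2)//; lia.
have n2 : (n.+1 <= n.+1.*2)%N by lia.
have cn := cnt n (leqnn n) n2.
have ck := cnt k nk k2n.
have sz : (n.+1.*2 <= size [seq l <- iota n.+1.*2 n.+1.*2 | bad (e / 2) n l] +
   size [seq l <- iota n.+1.*2 n.+1.*2 | bad (e / 2) k l])%N.
  rewrite !size_filter -count_predUI.
  apply: (@leq_trans (count (predU (bad (e / 2) n) (bad (e / 2) k)) (iota n.+1.*2 n.+1.*2))).
    have : all (predU (bad (e / 2) n) (bad (e / 2) k)) (iota n.+1.*2 n.+1.*2).
      apply/allP => l _ /=.
      apply/negP => /negP; rewrite negb_or => /andP[/negP b1 /negP b2].
      by apply: nol; exists l.
    by rewrite all_count size_iota => /eqP ->.
  exact: leq_addr.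
move: cn ck sz; set sn := size _; set sk := size _.
rewrite !ltr_pdivrMr// => cn ck; rewrite -(ler_nat R) natrD.
have : k.+1%:R <= n.+1.*2%:R :> R by rewrite ler_nat.
have : n.+1.*2%:R = 2 * n.+1%:R :> R by rewrite -muln2 natrM mulrC.
have : 0 < n.+1%:R :> R by [].
by move: cn ck; set a := k.+1%:R; set b := n.+1%:R; set c := n.+1.*2%:R; lra.
Qed.

End uniform_convergence.

Section karamata.
Context {R : realType}.
Variables (a : nat -> R) (rho : R).
Hypothesis a_rv : regularly_varying a rho.

Let a0 n : (0 < n)%N -> 0 < a n. Proof. by case: a_rv => h _; exact: h. Qed.

Let L (n : nat) : R := a n / n%:R `^ rho.

Let L0 n : (0 < n)%N -> 0 < L n.
Proof. by move=> n0; rewrite divr_gt0 ?a0// powR_gt0// ltr0n. Qed.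

Lemma slowly_varying_uniform (e : R) : 0 < e ->
  \forall n \near \oo, forall k, (n <= k <= n.*2)%N -> `|L k / L n - 1| <= e.
Proof.
move=> e0.
pose h n := ln (L n).
have h_cvg (lam : R) : 0 < lam ->
    h (Num.truncn (lam * n%:R)) - h n @[n --> \oo] --> 0.
  move=> l0; case: a_rv => _ /(_ _ l0) ha.
  have lp : 0 < lam `^ rho by exact: powR_gt0.
  have h1 : ln (a (Num.truncn (lam * n%:R)) / a n) @[n --> \oo] --> ln (lam `^ rho).
    by apply: cvg_comp ha _; exact: continuous_ln.
  have h2 : ln ((Num.truncn (lam * n%:R))%:R / n%:R) @[n --> \oo] --> ln lam.
    by apply: cvg_comp (truncn_ratio_cvg l0) _; exact: continuous_ln.
  apply: (cvg_near_eq (cvgB h1 (cvgM (cvg_cst rho) h2))).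
    by rewrite ln_powR subrr.
  near=> n.
  have n0 : (0 < n)%N by near: n; exists 1%N.
  have t0 : (0 < Num.truncn (lam * n%:R))%N by near: n; exact: truncn_cvg.
  have n0' : 0 < n%:R :> R by rewrite ltr0n.
  have t0' : 0 < (Num.truncn (lam * n%:R))%:R :> R by rewrite ltr0n.
  by rewrite !fctE /= /h /L !ln_div ?posrE ?powR_gt0 ?a0// !ln_powR; ring.
pose e' := Num.min (e / 2) (1 / 2).
have e'0 : 0 < e' by rewrite lt_min !divr_gt0.
have e'2 : e' <= 1 / 2 by rewrite ge_min lexx orbT.
have e'e : 2 * e' <= e by rewrite mulrC -ler_pdivlMr// ge_min lexx.
have := uniform_of_pointwise h_cvg e'0.
move=> H; near=> n => k /andP[nk kn].
have n0 : (0 < n)%N by near: n; exists 1%N.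
have : `|h k - h n| <= e'.
  have : forall k, (n <= k <= n.*2)%N -> `|h k - h n| <= e' by near: n.
  by apply; rewrite nk.
have k0 : (0 < k)%N by exact: leq_trans nk.
have -> : L k / L n = expR (h k - h n).
  by rewrite expRB /h !lnK ?posrE ?L0.
set x := h k - h n; rewrite ler_norml => /andP[x1 x2].
rewrite ler_norml; have := expR_ge1Dx x; have := expR_ge1Dx (- x) => nx px.
apply/andP; split; first by lra.
have ex : expR x * expR (- x) = 1 by exact: expRxMexpNx_1.
have := expR_gt0 x; move: nx ex; set y := expR (- x); set z := expR x => nx ex z0.
have zx : z * (1 - x) <= z * y by rewrite ler_pM2l.
have ze : z * (1 - e') <= z * (1 - x) by rewrite ler_pM2l//; lra.
have z2 : z * (1 / 2) <= z * (1 - e') by rewrite ler_pM2l//; lra.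
have : z * e' <= 2 * e' by rewrite ler_pM2r//; lra.
by lra.
Unshelve. all: by end_near. Qed.

(* [S n] is a smooth substitute for [n * L n]: it is equivalent to it, and its
   increment [L (2n + 1) + L (2n + 2) - L (n + 1)] is equivalent to [L n].
   Consequently [D n] is equivalent to [n * a n], while its increment is
   equivalent to [(1 + rho) * a n]. *)
Let S (n : nat) := \sum_(n.+1 <= k < n.*2.+1) L k.
Let D (n : nat) := n%:R `^ rho * S n.

Let S_ratio_cvg m : (m <= 1)%N -> S n / (n%:R * L (n + m)%N) @[n --> \oo] --> (1 : R).
Proof.
move=> m1; apply/cvgrPdist_le => e e0; near=> n.
have n0 : (0 < n)%N by near: n; exists 1%N.
have n0' : 0 < n%:R :> R by rewrite ltr0n.
have nm0 : (0 < n + m)%N by rewrite addn_gt0 n0.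
have Lnm := L0 nm0.
have H k : (n + m <= k <= (n + m).*2)%N -> `|L k / L (n + m) - 1| <= e.
  move: k; near: n.
  have [N _ HN] := slowly_varying_uniform e0.
  by exists N => // n Nn k; apply: HN; rewrite /= (leq_trans Nn)// leq_addr.
have SE : S n / (n%:R * L (n + m)) - 1 =
    (\sum_(n.+1 <= k < n.*2.+1) (L k / L (n + m) - 1)) / n%:R.
  rewrite sumrB -mulr_suml -/(S n) sumr_const_nat.
  have -> : (n.*2.+1 - n.+1)%N = n by lia.
  by field; rewrite !gt_eqF.
rewrite distrC SE normrM normfV (gtr0_norm n0') ler_pdivrMr//.
apply: le_trans (ler_norm_sum _ _ _) _.
apply: (@le_trans _ _ (\sum_(n.+1 <= k < n.*2.+1) e)).
  by apply: ler_sum_nat => k /andP[k1 k2]; apply: H; lia.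
rewrite sumr_const_nat (_ : (n.*2.+1 - n.+1)%N = n); last by lia.
by rewrite mulr_natr.
Unshelve. all: by end_near. Qed.

Let D_ratio_cvg : D n / (n%:R * a n) @[n --> \oo] --> (1 : R).
Proof.
apply: (cvg_near_eq (S_ratio_cvg (leq0n 1))) => //; near=> n.
have n0 : (0 < n)%N by near: n; exists 1%N.
have n0' : 0 < n%:R :> R by rewrite ltr0n.
rewrite addn0 /D /L; field.
by rewrite !gt_eqF ?a0 ?powR_gt0.
Unshelve. all: by end_near. Qed.

Let D_increment_cvg : (D n.+1 - D n) / a n.+1 @[n --> \oo] --> 1 + rho.
Proof.
have Lodd j : (0 < j <= 2)%N -> L (n.*2 + j)%N / L n.+1 @[n --> \oo] --> (1 : R).
  move=> j12; apply/cvgrPdist_le => e e0; near=> n; rewrite distrC.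
  have : forall k, (n.+1 <= k <= n.+1.*2)%N -> `|L k / L n.+1 - 1| <= e.
    near: n; have [N _ HN] := slowly_varying_uniform e0.
    by exists N => // n Nn; apply: HN; rewrite /= leqW.
  by apply; lia.
have h1 := Lodd 1%N isT; have h2 := Lodd 2%N isT.
have h3 : n.+1%:R * (1 - (n%:R / n.+1%:R) `^ rho) *
    (S n / (n%:R * L (n + 1)%N)) @[n --> \oo] --> rho * 1.
  by apply: cvgM; [exact: powR_difference_cvg|exact: S_ratio_cvg].
have h4 : n%:R / n.+1%:R @[n --> \oo] --> (1 : R).
  have : 1 - n.+1%:R^-1 @[n --> \oo] --> (1 - 0 : R).
    by apply: cvgB; [exact: cvg_cst|exact: cvg_harmonic].
  rewrite subr0 => /cvg_near_eq; apply => //; near=> n.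
  by rewrite -natr1; field; rewrite natr1 gt_eqF.
have h5 : L (n.*2 + 1)%N / L n.+1 + L (n.*2 + 2)%N / L n.+1 - 1 @[n --> \oo] -->
    (1 + 1 - 1 : R).
  by apply: cvgB; [exact: cvgD|exact: cvg_cst].
have h6 : L (n.*2 + 1)%N / L n.+1 + L (n.*2 + 2)%N / L n.+1 - 1 +
    n.+1%:R * (1 - (n%:R / n.+1%:R) `^ rho) *
    (S n / (n%:R * L (n + 1)%N)) * (n%:R / n.+1%:R) @[n --> \oo] -->
    (1 + 1 - 1 + rho * 1 * 1 : R).
  by apply: cvgD => //; exact: cvgM.
apply: (cvg_near_eq h6); first by rewrite !mulr1 addrK.
near=> n.
have n0 : (0 < n)%N by near: n; exists 1%N.
have SS : S n.+1 = S n + L (n.*2 + 1) + L (n.*2 + 2) - L n.+1.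
  rewrite /S doubleS (big_nat_recr n.*2.+2)//=; last by lia.
  rewrite (big_nat_recr n.*2.+1)//=; last by lia.
  rewrite [X in _ = X + _ + _ - _](big_ltn (m := n.+1))//=; last by lia.
  rewrite addn1 addn2; ring.
have n0' : 0 < n%:R :> R by rewrite ltr0n.
have n1 : 0 < n.+1%:R :> R by [].
have X0 : 0 < n.+1%:R `^ rho :> R by exact: powR_gt0.
have qE : (n%:R / n.+1%:R) `^ rho = n%:R `^ rho / n.+1%:R `^ rho :> R.
  apply: (mulIf (lt0r_neq0 X0)); rewrite divfK ?gt_eqF// -powRM ?divr_ge0//.
  by rewrite divfK// gt_eqF.
have aE : a n.+1 = n.+1%:R `^ rho * L n.+1 by rewrite /L mulrC divfK// gt_eqF.
rewrite /D SS aE qE (addn1 n); field.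
by rewrite !gt_eqF//= L0.
Unshelve. all: by end_near. Qed.

(* [D n] is of the order of [n * a n] and eventually increases, so that [a n] is
   at least of the order of [1 / n]. *)
Let sum_a_unbounded : -1 < rho -> \sum_(0 <= k < n) a k.+1 @[n --> \oo] --> +oo.
Proof.
move=> rho1.
have r0 : 0 < 1 + rho by lra.
have Dinc : \forall n \near \oo, D n <= D n.+1.
  move/cvgrPdist_lt : D_increment_cvg => /(_ _ r0); apply: filterS => n.
  rewrite ltr_norml => /andP[_]; rewrite ltrBlDr ltrDl.
  by rewrite pmulr_lgt0 ?invr_gt0 ?a0// subr_gt0 => /ltW.
have D2 : \forall n \near \oo, D n <= 2 * (n%:R * a n).
  move/cvgrPdist_le : D_ratio_cvg => /(_ _ ltr01) h; near=> n.
  have n0 : (0 < n)%N by near: n; exists 1%N.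
  have : `|1 - D n / (n%:R * a n)| <= 1 by near: n.
  rewrite ler_norml => /andP[h1 _]; rewrite -ler_pdivrMr; last first.
    by rewrite mulr_gt0 ?a0// ltr0n.
  by lra.
have D0 n : (0 < n)%N -> 0 < D n.
  move=> n0; rewrite mulr_gt0 ?powR_gt0 ?ltr0n// /S big_ltn; last by lia.
  by rewrite ltr_pwDl ?L0// big_nat_cond; apply: sumr_ge0 => k /andP[/andP[k1 _] _]; rewrite ltW// L0//; lia.
have [N _ HN] : \forall n \near \oo, D n <= D n.+1 /\ D n <= 2 * (n%:R * a n).
  by apply: filterS2 Dinc D2.
pose M := N.+1; have DM k : D M <= D (M + k)%N.
  elim: k => [|k IH]; first by rewrite addn0.
  by rewrite addnS (le_trans IH)//; have [] := HN (M + k)%N; rewrite /= /M; lia.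
have c0 : 0 < D M / 2 by rewrite divr_gt0 ?D0.
apply/cvgryPge => A.
have [k Hk] := harmonic_tail_unbounded M A c0.
exists (M + k)%N => // n /= nk; apply: (le_trans Hk).
rewrite (big_cat_nat (n := M))//=; last by rewrite (leq_trans _ nk)// leq_addr.
rewrite [X in _ <= _ + X](big_cat_nat (n := (M + k)%N))//= ?leq_addr//.
have a0' i : 0 <= a i.+1 by rewrite ltW// a0.
rewrite ler_wpDl ?sumr_ge0// ler_wpDr ?sumr_ge0//.
rewrite /index_iota addKn big_seq [leRHS]big_seq; apply: ler_sum => j.
rewrite mem_iota => /andP[Mj _].
have j1 : 0 < j.+1%:R :> R by [].
rewrite ler_pdivrMr// ler_pdivrMr//.
apply: (@le_trans _ _ (D j.+1)).
  by rewrite -[j.+1](subnKC (leqW Mj)); exact: DM.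
have [_ h] := HN j.+1 (leqW (ltnW Mj)).
by apply: (le_trans h); rewrite le_eqVlt; apply/orP; left; apply/eqP; ring.
Unshelve. all: by end_near. Qed.

(** Karamata's theorem: compare the sums of [a] with those of the increments of
   [D], which telescope. *)
Lemma karamata : -1 < rho ->
  (\sum_(1 <= k < n.+1) a k) / (n%:R * a n) @[n --> \oo] --> (1 + rho)^-1.
Proof.
move=> rho1.
have a1 k : 0 < a k.+1 by exact: a0.
have r0 : 1 + rho != 0 by rewrite gt_eqF//; lra.
have h1 : D n / (n%:R * a n) * ((\sum_(0 <= k < n) (D k.+1 - D k)) /
    \sum_(0 <= k < n) a k.+1)^-1 @[n --> \oo] --> 1 * (1 + rho)^-1.
  apply: cvgM => //; apply: cvgV => //.
  exact: (weighted_cesaro a1 (sum_a_unbounded rho1) D_increment_cvg).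
apply: (cvg_near_eq h1); first by rewrite mul1r.
near=> n.
have n0 : (0 < n)%N by near: n; exists 1%N.
have n0' : 0 < n%:R :> R by rewrite ltr0n.
have S0 : 0 < S n.
  rewrite /S big_ltn; last by lia.
  by rewrite ltr_pwDl ?L0// big_nat_cond; apply: sumr_ge0 => k /andP[/andP[k1 _] _]; rewrite ltW// L0//; lia.
have D0 : D n != 0 by rewrite gt_eqF// mulr_gt0 ?powR_gt0.
rewrite /= telescope_sumr// (_ : D 0%N = 0); last first.
  by rewrite /D /S big_geq// mulr0.
rewrite subr0 invf_div big_add1/=; field.
by rewrite D0 !gt_eqF// a0.
Unshelve. all: by end_near. Qed.
End karamata.

(** * From weighted means to step functionals *)

Section path_comparison.
Context {R : realType}.
Variables (a b m : nat -> R) (f : R -> R) (rho1 rho2 : R).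
Hypotheses (a_rv : regularly_varying a rho1) (b_rv : regularly_varying b rho2).
Hypothesis b_mono : forall i j : nat, (0 < i)%N -> (i <= j)%N -> b i <= b j.
Hypothesis b_oo : b n @[n --> \oo] --> +oo.
Hypotheses (rho1_gt : -1 < rho1) (rho2_ge0 : 0 <= rho2).
Hypothesis f_bnd : loglog_bounded f.
Hypothesis m_approx : forall e, 0 < e ->
  \forall n \near \oo, `|m n / a n - f (b n)| <= e * phi (b n).

Definition scaled_mean (n : nat) : R := (\sum_(1 <= k < n.+1) m k) / (n%:R * a n).

Let a0 n : (0 < n)%N -> 0 < a n. Proof. by case: a_rv => h _; exact: h. Qed.
Let b0 n : (0 < n)%N -> 0 < b n. Proof. by case: b_rv => h _; exact: h. Qed.

Let al := 1 + rho1.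
Let al0 : 0 < al. Proof. by rewrite /al -ltrBlDl sub0r. Qed.

Let A (n : nat) := \sum_(1 <= k < n.+1) a k.

Let A_ratio_cvg (lam : R) : 0 < lam ->
  A (Num.truncn (lam * n%:R)) / (n%:R * a n) @[n --> \oo] --> lam `^ al / al.
Proof.
move=> l0; case: a_rv => _ /(_ _ l0) ha.
have toy : Num.truncn (lam * n%:R) @[n --> \oo] --> \oo.
  by apply/cvgnyPge => N; exact: truncn_cvg.
have h1 : A (Num.truncn (lam * n%:R)) /
    ((Num.truncn (lam * n%:R))%:R * a (Num.truncn (lam * n%:R))) @[n --> \oo] --> al^-1.
  exact: cvg_comp toy (karamata a_rv rho1_gt).
have h2 : A (Num.truncn (lam * n%:R)) /
    ((Num.truncn (lam * n%:R))%:R * a (Num.truncn (lam * n%:R))) *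
    ((Num.truncn (lam * n%:R))%:R / n%:R) *
    (a (Num.truncn (lam * n%:R)) / a n) @[n --> \oo] --> al^-1 * lam * lam `^ rho1.
  by apply: cvgM => //; apply: cvgM => //; exact: truncn_ratio_cvg.
apply: (cvg_near_eq h2).
  by rewrite /al powRD ?powRr1 ?(ltW l0)//; [field; rewrite gt_eqF|rewrite gt_eqF ?implybT].
near=> n.
have n0 : (0 < n)%N by near: n; exists 1%N.
have t0 : (0 < Num.truncn (lam * n%:R))%N by near: n; exact: truncn_cvg.
by field; rewrite !gt_eqF ?a0 ?ltr0n.
Unshelve. all: by end_near. Qed.

Let A_mono i j : (i <= j)%N -> A i <= A j.
Proof.
move=> ij; rewrite /A (big_cat_nat (n := i.+1) (p := j.+1))//= ler_wpDr//.
by rewrite big_nat_cond sumr_ge0// => k /andP[/andP[k1 _] _]; rewrite ltW// a0//; lia.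
Qed.

Variables (r : R) (r01 : 0 < r < 1).

Let p := r `^ al.
Let q := r `^ rho2.

(** The limit, given by Karamata's theorem, of the share of the indices [k] with
   [r ^+ i.+1 * n < k <= r ^+ i * n] in the weighted mean. *)
Definition weight i := (p ^+ i - p ^+ i.+1) / al.

Definition step_functional (I : nat) (t : R) := \sum_(i < I) weight i * f (q ^+ i * t).

Let nn (i n : nat) := Num.truncn (r ^+ i * n%:R).

Let r0 : 0 < r. Proof. by case/andP: r01. Qed.
Let ri0 i : 0 < r ^+ i. Proof. exact: exprn_gt0. Qed.
Let p0 : 0 < p. Proof. exact: powR_gt0. Qed.
Let q0 : 0 < q. Proof. exact: powR_gt0. Qed.
Let p1 : p < 1.
Proof.
case/andP: r01 => _ r1; have -> : 1 = 1 `^ al :> R by rewrite powR1.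
by apply: gt0_ltr_powR => //; rewrite ?nnegrE ?ltW.
Qed.
Let q1 : q <= 1.
Proof.
case/andP: r01 => _ r1; have -> : 1 = 1 `^ rho2 :> R by rewrite powR1.
by apply: ge0_ler_powR => //; rewrite ?nnegrE ?ltW.
Qed.

Let powRX (x : R) i : (r ^+ i) `^ x = (r `^ x) ^+ i.
Proof. by rewrite -powR_mulrn ?(ltW r0)// powRAC powR_mulrn// powR_ge0. Qed.

Let nn0 n : nn 0 n = n. Proof. by rewrite /nn mul1r natrK. Qed.

Let nnS i n : (nn i.+1 n <= nn i n)%N.
Proof.
apply: le_truncn; apply: ler_wpM2r => //; case/andP: r01 => _ r1.
by rewrite exprS ler_piMl ?exprn_ge0 ?ltW.
Qed.

Let blocks (g : nat -> R) (I n : nat) : \sum_(1 <= k < n.+1) g k =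
  \sum_(1 <= k < (nn I n).+1) g k +
  \sum_(i < I) \sum_((nn i.+1 n).+1 <= k < (nn i n).+1) g k.
Proof.
elim: I => [|I IH]; first by rewrite big_ord0 addr0 nn0.
rewrite big_ord_recr/= IH (big_cat_nat (n := (nn I.+1 n).+1))//= ?ltnS//.
by rewrite -!addrA; congr (_ + _); rewrite addrC.
Qed.

(** On a block [nn i.+1 n < k <= nn i n], [b k] is within a factor close to one
   of [q ^+ i * b n], so that the modulus of continuity lets one replace
   [m k / a k] by [f (q ^+ i * b n)]; the weights of the blocks are then given by
   Karamata's theorem, which also bounds the contribution of [k <= nn I n]. *)
Lemma scaled_mean_step_functional (e dl : R) : 0 < e -> 0 < dl ->
  (exists T0, forall s t, T0 <= t -> t <= s <= (1 + dl) * t -> `|f s - f t| <= e * phi s) ->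
  1 < (1 + dl) * q ->
  exists I0, forall I, (I0 <= I)%N -> \forall n \near \oo,
    `|scaled_mean n - step_functional I (b n)| <= (4 / al + 4) * e * phi (b n).
Proof.
move=> e0 dl0 [T0 HT0] dlq.
(* [21 = 1 + 20] bounds [m k / a k] in units of [phi (b k)], and [p ^+ I / al] is
   the limiting weight of the indices [k <= nn I n] *)
have [I0 HI0] : exists I0, forall I, (I0 <= I)%N -> 21 * p ^+ I < e * al.
  have : p ^+ I @[I --> \oo] --> 0 by apply: cvg_expr; rewrite gtr0_norm.
  have ea : 0 < e * al / 21 by rewrite divr_gt0// mulr_gt0.
  move/cvgrPdist_lt => /(_ _ ea)[I0 _ H]; exists I0 => I /H /=.
  by rewrite sub0r normrN ger0_norm ?exprn_ge0 ?(ltW p0)// ltr_pdivlMr// mulrC.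
exists I0 => I /HI0 pI.
have [T1 HT1] := f_bnd.
pose T2 := Num.max (Num.max T0 T1) (expR 1).
have [K1 HK1] : exists2 K1, (0 < K1)%N & forall k, (K1 <= k)%N -> T2 <= b k /\
    `|m k / a k - f (b k)| <= Num.min e 1 * phi (b k).
  have e'0 : 0 < Num.min e 1 by rewrite lt_min e0 ltr01.
  have [N _ HN] : \forall k \near \oo, T2 <= b k /\
      `|m k / a k - f (b k)| <= Num.min e 1 * phi (b k).
    near=> k; split; near: k; last exact: m_approx.
    by move/cvgryPge : b_oo; apply.
  by exists N.+1 => // k Nk; apply: HN; exact: ltnW.
move=> HK.
pose C0 := \sum_(1 <= k < K1) `|m k|.
have C00 : 0 <= C0 by exact: sumr_ge0.
(* the errors on the [I] weights are each multiplied by a value of [f], hence by at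
   most [20 * phi (b n)] *)
pose e2 := e / (20 * I.+1%:R).
have e20 : 0 < e2 by rewrite divr_gt0// mulr_gt0.
have phiy : phi (b n) @[n --> \oo] --> +oo by exact: cvg_comp b_oo (@phi_cvg R).
have a1 : 0 < a 1%N by exact: a0.
have HAn : \forall n \near \oo, A n / (n%:R * a n) <= 2 / al.
  have ali : 0 < al^-1 by rewrite invr_gt0.
  have := karamata a_rv rho1_gt; move/cvgrPdist_le => /(_ _ ali); apply: filterS => n.
  rewrite -/al -/(A n) ler_norml => /andP[+ _].
  rewrite mulr2n mulrDl mul1r; set x := _ / _; set y := al^-1.
  by lra.
have HAi : \forall n \near \oo, forall i, (i <= I)%N ->
    `|A (nn i n) / (n%:R * a n) - p ^+ i / al| <= e2 / 2.
  apply: near_forall_leq => i _.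
  have e22 : 0 < e2 / 2 by rewrite divr_gt0.
  have := A_ratio_cvg (ri0 i); rewrite powRX => /cvgrPdist_le/(_ _ e22).
  by apply: filterS => n; rewrite distrC.
have Hbi : \forall n \near \oo, forall i, (i <= I)%N ->
    b (nn i n) <= (1 + dl) * (q ^+ i * b n) /\ q ^+ i * b n <= (1 + dl) * b (nn i.+1 n).
  apply: near_forall_leq => i _; case: b_rv => _ hb.
  have qi0 : 0 < q ^+ i by exact: exprn_gt0.
  have := hb _ (ri0 i); rewrite powRX -/q => hbi.
  have := hb _ (ri0 i.+1); rewrite powRX -/q => hbi1.
  near=> n; have bn0 : 0 < b n by apply: b0; near: n; exists 1%N.
  split.
    rewrite mulrA -ler_pdivrMr//.
    near: n; apply: (cvgr_le (q ^+ i)) => //; by rewrite ltr_pMl// ltrDl.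
  rewrite -ler_pdivrMl ?addr_gt0// mulrA -ler_pdivlMr//.
  near: n; apply: (cvgr_ge (q ^+ i.+1)) => //.
  by rewrite ltr_pdivrMl ?addr_gt0// exprS mulrA ltr_pMl.
have HC0 : \forall n \near \oo, C0 * (2 / al / a 1%N) / e <= phi (b n).
  by move/cvgryPge : phiy => /(_ (C0 * (2 / al / a 1%N) / e)).
have HqI : \forall n \near \oo, T2 <= q ^+ I * b n.
  move/cvgryPge : b_oo => /(_ (T2 / q ^+ I)); apply: filterS => n.
  by rewrite ler_pdivrMr ?exprn_gt0// mulrC.
near=> n.
have n0 : (0 < n)%N by near: n; exists 1%N.
have na0 : 0 < n%:R * a n by rewrite mulr_gt0 ?a0// ltr0n.
pose ph := phi (b n).
have ph0 : 0 <= ph by exact: phi_ge0.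
have nI : (K1 <= nn I n)%N by near: n; exact: truncn_cvg.
have nnI i : (i <= I)%N -> (nn I n <= nn i n)%N.
  by move=> iI; rewrite -(subnK iI); elim: (I - i)%N => [//|j IH]; exact: leq_trans (nnS _ _) IH.
have nin i : (nn i n <= n)%N.
  by elim: i => [|i IH]; [rewrite nn0|exact: leq_trans (nnS _ _) IH].
have phk k : (K1 <= k <= n)%N -> phi (b k) <= ph.
  move=> /andP[Kk kn]; have [Tb _] := HK k Kk; apply: le_phi.
    by apply: le_trans Tb; rewrite le_max lexx orbT.
  by apply: b_mono => //; exact: leq_trans Kk.
have An : A n / (n%:R * a n) <= 2 / al by near: n.
have Ai i : (i <= I)%N -> `|A (nn i n) / (n%:R * a n) - p ^+ i / al| <= e2 / 2.
  by move: i; near: n.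
have bi i : (i <= I)%N -> b (nn i n) <= (1 + dl) * (q ^+ i * b n) /\
    q ^+ i * b n <= (1 + dl) * b (nn i.+1 n).
  by move: i; near: n.
have qIb : T2 <= q ^+ I * b n by near: n.
have C0n : C0 / (n%:R * a n) <= e * ph.
  have C0ph : C0 * (2 / al / a 1%N) / e <= ph by rewrite /ph; near: n.
  apply: (@le_trans _ _ (C0 * (2 / al / a 1%N))); last by rewrite [leRHS]mulrC -ler_pdivrMr.
  apply: ler_wpM2l => //; rewrite ler_pdivlMr//; apply: le_trans An.
  rewrite mulrC; apply: ler_wpM2r; first by rewrite invr_ge0 ltW.
  by apply: (le_trans _ (A_mono n0)); rewrite /A big_nat1.
have bn0 : 0 < b n by exact: b0.
have qib i : (i <= I)%N -> T2 <= q ^+ i * b n <= b n.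
  move=> iI; rewrite ler_piMl ?exprn_ile1 ?(ltW bn0) ?(ltW q0)// andbT.
  apply: (le_trans qIb); rewrite ler_pM2r//; apply: ler_wiXn2l => //; exact: ltW.
have T2E t : T2 <= t -> [/\ T0 <= t, T1 <= t & expR 1 <= t].
  by rewrite !ge_max => /andP[/andP[-> ->] ->].
have fi i : (i <= I)%N -> `|f (q ^+ i * b n)| <= 20 * ph.
  move=> /qib/andP[/T2E[_ t1 te] qb]; apply: (le_trans (HT1 _ t1)).
  by rewrite ler_pM2l//; exact: le_phi.
have mk k : (K1 <= k <= n)%N -> `|m k| <= 21 * ph * a k.
  move=> Kkn; have /andP[Kk kn] := Kkn; have [/T2E[_ t1 _] h] := HK k Kk.
  have ak : 0 < a k by apply: a0; exact: leq_trans Kk.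
  have -> : `|m k| = `|m k / a k| * a k.
    by rewrite normrM normfV (gtr0_norm ak) divfK// gt_eqF.
  rewrite ler_pM2r//; have -> : m k / a k = (m k / a k - f (b k)) + f (b k) by ring.
  apply: le_trans (ler_normD _ _) _.
  have h1 : `|m k / a k - f (b k)| <= phi (b k).
    by apply: (le_trans h); rewrite ler_piMl ?phi_ge0// ge_min lexx orbT.
  by have := HT1 _ t1; have := phk k Kkn; lra.
have mfk i k : (i < I)%N -> ((nn i.+1 n).+1 <= k < (nn i n).+1)%N ->
    `|m k / a k - f (q ^+ i * b n)| <= 2 * e * ph.
  move=> iI /andP[k1]; rewrite ltnS => k2; have k2n : (k <= n)%N by exact: leq_trans k2 (nin i).
  have Kk : (K1 <= k)%N by rewrite (leq_trans nI)// (leq_trans (nnI i.+1 iI))// ltnW.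
  have [/T2E[tb0 _ tbe] h] := HK k Kk.
  have /andP[/T2E[tq0 _ tqe] qb] := qib i (ltnW iI).
  have [bi1 bi2] := bi i (ltnW iI).
  have kle : (K1 <= k <= n)%N by rewrite Kk k2n.
  have phkn := phk k kle.
  have -> : m k / a k - f (q ^+ i * b n) =
    (m k / a k - f (b k)) + (f (b k) - f (q ^+ i * b n)) by ring.
  apply: le_trans (ler_normD _ _) _.
  have h1 : `|m k / a k - f (b k)| <= e * ph.
    apply: (le_trans h); apply: ler_pM => //; first by rewrite le_min (ltW e0) ler01.
      exact: phi_ge0.
    by rewrite ge_min lexx.
  have h2 : `|f (b k) - f (q ^+ i * b n)| <= e * ph.
    have bk1 : b k <= b (nn i n) by apply: b_mono => //; exact: leq_trans Kk.
    have bk2 : b (nn i.+1 n) <= b k.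
      apply: b_mono; last exact: ltnW.
      by apply: leq_trans HK1 _; apply: (leq_trans nI); exact: nnI.
    have [le|/ltW le] := leP (q ^+ i * b n) (b k).
      apply: le_trans (HT0 _ _ tq0 _) _; first by rewrite le (le_trans bk1).
      by rewrite ler_pM2l.
    rewrite distrC; apply: le_trans (HT0 _ _ tb0 _) _.
      by rewrite le (le_trans bi2)// ler_pM2l// addr_gt0.
    by rewrite ler_pM2l//; exact: le_phi.
  by have := lerD h1 h2; lra.
set N := n%:R * a n.
pose dA i := A (nn i n) - A (nn i.+1 n).
have dAE i : \sum_((nn i.+1 n).+1 <= k < (nn i n).+1) a k = dA i.
  by rewrite /dA /A [X in _ = X - _](big_cat_nat (n := (nn i.+1 n).+1))//= ?ltnS// addrAC subrr add0r.
have tail : `|\sum_(1 <= k < (nn I n).+1) m k| <= C0 + 21 * ph * A (nn I n).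
  rewrite (big_cat_nat (n := K1))//=; last exact: leqW.
  apply: le_trans (ler_normD _ _) _; apply: lerD; first exact: ler_norm_sum.
  apply: le_trans (ler_norm_sum _ _ _) _.
  apply: (@le_trans _ _ (\sum_(K1 <= k < (nn I n).+1) 21 * ph * a k)).
    apply: ler_sum_nat => k /andP[Kk kI]; apply: mk.
    by rewrite Kk/= (leq_trans _ (nin I)).
  rewrite -mulr_sumr ler_wpM2l ?mulr_ge0// /A.
  rewrite [leRHS](big_cat_nat (n := K1))//=; last exact: leqW.
  by rewrite lerDr big_nat_cond sumr_ge0// => k /andP[/andP[k1 _] _]; rewrite ltW// a0.
have block i : (i < I)%N ->
    `|(\sum_((nn i.+1 n).+1 <= k < (nn i n).+1) m k) / N - weight i * f (q ^+ i * b n)| <=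
    2 * e * ph * (dA i / N) + e2 * (20 * ph).
  move=> iI.
  have -> : (\sum_((nn i.+1 n).+1 <= k < (nn i n).+1) m k) / N - weight i * f (q ^+ i * b n) =
    (\sum_((nn i.+1 n).+1 <= k < (nn i n).+1) (m k - a k * f (q ^+ i * b n))) / N +
    (dA i / N - weight i) * f (q ^+ i * b n).
    by rewrite sumrB -mulr_suml dAE; ring.
  apply: le_trans (ler_normD _ _) _; apply: lerD.
    rewrite normrM normfV (gtr0_norm na0) mulrA ler_wpM2r ?invr_ge0 ?(ltW na0)//.
    apply: le_trans (ler_norm_sum _ _ _) _; rewrite -(dAE i) mulr_sumr.
    apply: ler_sum_nat => k kk; have ak : 0 < a k.
      by apply: a0; case/andP: kk => k1 _; exact: leq_ltn_trans k1.
    have -> : m k - a k * f (q ^+ i * b n) = (m k / a k - f (q ^+ i * b n)) * a k.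
      by field; rewrite gt_eqF.
    by rewrite normrM (gtr0_norm ak) ler_pM2r//; exact: mfk.
  rewrite normrM; apply: ler_pM => //; last exact: fi (ltnW iI).
  have := Ai i (ltnW iI); have := Ai i.+1 iI; rewrite -/N.
  have -> : dA i / N - weight i = (A (nn i n) / N - p ^+ i / al) -
      (A (nn i.+1 n) / N - p ^+ i.+1 / al) by rewrite /dA /weight; ring.
  move=> h1 h2; apply: le_trans (ler_normB _ _) _.
  by apply: le_trans (lerD h2 h1) _; rewrite -splitr.
have -> : scaled_mean n - step_functional I (b n) = (\sum_(1 <= k < (nn I n).+1) m k) / N +
    \sum_(i < I) ((\sum_((nn i.+1 n).+1 <= k < (nn i n).+1) m k) / N - weight i * f (q ^+ i * b n)).
  rewrite /scaled_mean (blocks _ I) /step_functional sumrB mulrDl -/N -addrA.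
  by congr (_ + (_ - _)); rewrite mulr_suml.
apply: le_trans (ler_normD _ _) _.
have e2I : I.+1%:R * (20 * e2) = e.
  by rewrite /e2; set k := I.+1%:R; have k0 : k != 0; [rewrite pnatr_eq0|field].
have e2I' : 20 * e2 <= e by rewrite -e2I ler_peMl ?ler1n// mulr_ge0// ltW.
have tailN : `|(\sum_(1 <= k < (nn I n).+1) m k) / N| <= 3 * e * ph.
  rewrite normrM normfV (gtr0_norm na0) ler_pdivrMr//; apply: (le_trans tail).
  have : A (nn I n) <= (p ^+ I / al + e2 / 2) * N.
    rewrite -ler_pdivrMr//; have := Ai I (leqnn I); rewrite ler_norml -/N => /andP[_]; lra.
  have : C0 <= e * ph * N by rewrite -ler_pdivrMr.
  have pI' : 21 * (p ^+ I / al) <= e by rewrite mulrA ler_pdivrMr// ltW.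
  have phN : 0 <= ph * N by rewrite mulr_ge0// ltW.
  set AI := A _; set P' := p ^+ I / al in pI' *.
  move=> h1 h2.
  have h3 : 21 * ph * AI <= ph * N * (21 * P' + 21 / 2 * e2).
    have -> : ph * N * (21 * P' + 21 / 2 * e2) = 21 * ph * ((P' + e2 / 2) * N) by field.
    by rewrite ler_wpM2l// mulr_ge0.
  have h4 : ph * N * (21 * P' + 21 / 2 * e2) <= ph * N * (2 * e).
    by rewrite ler_wpM2l//; lra.
  by rewrite (_ : 3 * e * ph * N = e * ph * N + ph * N * (2 * e)); [lra|ring].
have blocksN : `|\sum_(i < I) ((\sum_((nn i.+1 n).+1 <= k < (nn i n).+1) m k) / N -
    weight i * f (q ^+ i * b n))| <= (4 / al + 1) * e * ph.
  apply: le_trans (ler_norm_sum _ _ _) _.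
  apply: (@le_trans _ _ (\sum_(i < I) (2 * e * ph * (dA i / N) + e2 * (20 * ph)))).
    by apply: ler_sum => i _; exact: block.
  rewrite big_split/= -mulr_sumr -mulr_suml sumr_const card_ord.
  have -> : \sum_(i < I) dA i = A n - A (nn I n).
    elim: (I) => [|j IH]; first by rewrite big_ord0 nn0 subrr.
    by rewrite big_ord_recr/= IH /dA; ring.
  have -> : (4 / al + 1) * e * ph = 4 / al * e * ph + e * ph by ring.
  apply: lerD.
    have -> : 4 / al * e * ph = 2 * e * ph * (2 / al) by field; rewrite gt_eqF.
    apply: ler_wpM2l; first by rewrite !mulr_ge0// ltW.
    apply: le_trans An; rewrite ler_pM2r ?invr_gt0// gerBl.
    by rewrite /A big_nat_cond sumr_ge0// => k /andP[/andP[k1 _] _]; rewrite ltW// a0.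
  rewrite -[leLHS]mulr_natr -[X in _ <= X * _]e2I.
  have -> : e2 * (20 * ph) * I%:R = I%:R * (20 * e2) * ph by ring.
  rewrite ler_wpM2r// ler_wpM2r ?ler_nat//.
  by rewrite mulr_ge0// ltW.
by have := lerD tailN blocksN; rewrite -!mulrDl; have -> : 3 + (4 / al + 1) = 4 / al + 4 by ring.
Unshelve. all: by end_near. Qed.
End path_comparison.

(** * Variance of the step functionals *)

Section weights.
Context {R : realType}.
Variables (p q al : R).

(** The partition of [0, 1] by the powers [q ^+ j], [j < I], listed in increasing
   order after the point [x]. *)
Definition geom_times (I : nat) (x : R) (i : nat) : R :=
  if i is 0 then x else q ^+ (I - i).

(** The sum of the weights [(p ^+ j - p ^+ j.+1) / al] of the points
   [q ^+ j], [j < I - i]. *)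
Definition cumul_weight (I i : nat) : R := (1 - p ^+ (I - i)) / al.

Let G I (x : R) (j : nat) : R := if (j < I)%N then q ^+ j else x.

Let cumul (j : nat) : R := (1 - p ^+ j) / al.

Let geom_timesG I x j : (j <= I)%N -> geom_times I x (I - j) = G I x j.
Proof.
rewrite leq_eqVlt => /orP[/eqP ->|jI]; first by rewrite subnn /G ltnn.
rewrite /geom_times /G jI; case E : (I - j)%N => [|k]; first by lia.
by congr (_ ^+ _); lia.
Qed.

Let rev_sum (F : R -> R -> R -> R) I x :
  \sum_(i < I) F (cumul_weight I i) (geom_times I x i.+1) (geom_times I x i) =
  \sum_(j < I) F (cumul j.+1) (G I x j) (G I x j.+1).
Proof.
rewrite (reindex_inj rev_ord_inj); apply: eq_bigr => j _.
have -> : nat_of_ord (rev_ord j) = (I - j.+1)%N by [].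
have jI := ltn_ord j.
have e1 : (I - (I - j.+1))%N = j.+1 by rewrite subKn.
have e2 : (I - j.+1).+1 = (I - j)%N by rewrite subnSK.
rewrite /cumul_weight e1 e2 (geom_timesG x (ltnW jI)).
by rewrite (geom_timesG x jI).
Qed.

Lemma geom_times_mono I x : 0 < q <= 1 -> x <= q ^+ I.-1 ->
  {homo geom_times I x : i j / (i <= j)%N >-> i <= j}.
Proof.
move=> /andP[q0 q1] xq [|i] [|j]//= ij.
  by apply: (le_trans xq); apply: ler_wiXn2l => //; [exact: ltW|lia].
by apply: ler_wiXn2l => //; [exact: ltW|lia].
Qed.

Lemma geom_times_last I x : (0 < I)%N -> geom_times I x I = 1.
Proof. by case: I => // k _; rewrite /geom_times subnn. Qed.

(** Summation by parts. *)
Lemma weighted_sum_inc_sum (f : R -> R) I (x : R) :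
  \sum_(i < I) cumul_weight I i * (f (geom_times I x i.+1) - f (geom_times I x i)) =
  \sum_(j < I) ((p ^+ j - p ^+ j.+1) / al) * f (q ^+ j) - cumul_weight I 0 * f x.
Proof.
rewrite (rev_sum (fun c y z => c * (f y - f z))).
have -> : \sum_(j < I) ((p ^+ j - p ^+ j.+1) / al) * f (q ^+ j) =
    \sum_(j < I) ((p ^+ j - p ^+ j.+1) / al) * f (G I x j).
  by apply: eq_bigr => j _; rewrite /G ltn_ord.
have -> : cumul_weight I 0 * f x = cumul I * f (G I x I).
  by rewrite /cumul_weight /G ltnn subn0.
move: (G I x) => g; elim: I => [|k IH].
  by rewrite !big_ord0 /cumul expr0 subrr mul0r mul0r subr0.
by rewrite !big_ord_recr/= IH /cumul; ring.
Qed.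

Lemma geom_inc_var I (x : R) : (0 < I)%N -> al != 0 -> p * q != 1 -> p ^+ 2 * q != 1 ->
  al ^+ 2 * inc_var I (geom_times I x) (cumul_weight I) =
  1 - 2 * p * (1 - q) / (1 - p * q) + p ^+ 2 * (1 - q) / (1 - p ^+ 2 * q) +
  (2 * p * (1 - q) / (1 - p * q) * (p * q) ^+ I -
   p ^+ 2 * (1 - q) / (1 - p ^+ 2 * q) * (p ^+ 2 * q) ^+ I -
   2 * (p * q) ^+ I + (p ^+ 2 * q) ^+ I) - (1 - p ^+ I) ^+ 2 * x.
Proof.
move=> I0 al0 pq ppq.
rewrite /inc_var (rev_sum (fun c y z => c ^+ 2 * (y - z))).
have d1 : 1 - p * q != 0 by rewrite subr_eq0 eq_sym.
have d2 : 1 - p ^+ 2 * q != 0 by rewrite subr_eq0 eq_sym.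
have H k : al ^+ 2 * (\sum_(j < k) cumul j.+1 ^+ 2 * (q ^+ j - q ^+ j.+1)) =
   1 - q ^+ k - 2 * p * (1 - q) / (1 - p * q) * (1 - (p * q) ^+ k) +
   p ^+ 2 * (1 - q) / (1 - p ^+ 2 * q) * (1 - (p ^+ 2 * q) ^+ k).
  elim: k => [|k IH]; first by rewrite big_ord0 !expr0; ring.
  rewrite big_ord_recr/= mulrDr IH /cumul !exprMn !exprS.
  by set P := p ^+ k; set Q := q ^+ k; field; rewrite al0 d1 d2.
(* only the last interval of the partition differs from the case [x = q ^+ I] *)
have -> : \sum_(j < I) cumul j.+1 ^+ 2 * (G I x j - G I x j.+1) =
    \sum_(j < I) cumul j.+1 ^+ 2 * (q ^+ j - q ^+ j.+1) + cumul I ^+ 2 * (q ^+ I - x).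
  rewrite /G; case: I I0 => // k _.
  rewrite !big_ord_recr/= ltnSn ltnn -addrA; congr (_ + _); last by ring.
  by apply: eq_bigr => j _; have jk := ltn_ord j; rewrite ltnS (ltnW jk) ltnS jk.
rewrite mulrDr H /cumul !exprMn.
by set P := p ^+ I; set Q := q ^+ I; field; rewrite al0 d1 d2.
Qed.
End weights.

Lemma ratio_powR_cvg {R : realType} (x : R) :
  (n%:R / n.+1%:R) `^ x @[n --> \oo] --> (1 : R).
Proof.
have h : 1 - n.+1%:R^-1 * (n.+1%:R * (1 - (n%:R / n.+1%:R) `^ x)) @[n --> \oo] -->
    (1 - 0 * x : R).
  apply: cvgB; first exact: cvg_cst.
  by apply: cvgM; [exact: cvg_harmonic|exact: powR_difference_cvg].
apply: (cvg_near_eq h); first by rewrite mul0r subr0.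
by apply: nearW => n; rewrite mulKf ?pnatr_eq0// opprB addrC subrK.
Qed.

Section limit_variance.
Context {R : realType}.
Variables (al be : R).
Hypotheses (al0 : 0 < al) (be0 : 0 <= be).

(** The limit, as the number of points tends to infinity, of the variance of the
   step functional of ratio [r]. *)
Definition geom_variance (r : R) :=
  let p := r `^ al in let q := r `^ be in
  (1 - 2 * p * (1 - q) / (1 - p * q) + p ^+ 2 * (1 - q) / (1 - p ^+ 2 * q)) / al ^+ 2.

Lemma geom_variance_cvg :
  geom_variance (n%:R / n.+1%:R) @[n --> \oo] --> 2 / ((al + be) * (2 * al + be)).
Proof.
pose r n : R := n%:R / n.+1%:R.
pose u x n : R := n.+1%:R * (1 - r n `^ x).
have ucvg x : u x n @[n --> \oo] --> x by exact: powR_difference_cvg.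
have p1 : r n `^ al @[n --> \oo] --> (1 : R) by exact: ratio_powR_cvg.
have ab0 : al + be != 0 by rewrite gt_eqF// ltr_wpDr.
have aab0 : 2 * al + be != 0 by rewrite gt_eqF// ltr_wpDr// mulr_gt0.
have h : (1 - 2 * r n `^ al * (u be n / u (al + be) n) +
    r n `^ al ^+ 2 * (u be n / u (2 * al + be) n)) / al ^+ 2 @[n --> \oo] -->
    (1 - 2 * 1 * (be / (al + be)) + 1 ^+ 2 * (be / (2 * al + be))) / al ^+ 2.
  apply: cvgM; last exact: cvg_cst.
  have quo x : x != 0 -> u be n / u x n @[n --> \oo] --> be / x.
    by move=> x0; apply: cvgM => //; exact: cvgV.
  apply: cvgD.
    apply: cvgB; first exact: cvg_cst.
    by apply: cvgM; [apply: cvgM => //; exact: cvg_cst|exact: quo].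
  by apply: cvgM; [apply: cvgM|exact: quo].
apply: (cvg_near_eq h); first by field; rewrite ab0 aab0 gt_eqF.
near=> n.
have n0 : (0 < n)%N by near: n; exists 1%N.
have r0 : 0 < r n by rewrite divr_gt0 ?ltr0n.
have pq : r n `^ (al + be) = r n `^ al * r n `^ be by rewrite powRD// (gt_eqF r0) implybT.
have ppq : r n `^ (2 * al + be) = r n `^ al ^+ 2 * r n `^ be.
  rewrite powRD; last by rewrite (gt_eqF r0) implybT.
  by rewrite [2 * al]mulrC powRrM powR_mulrn// powR_ge0.
have n1 : n.+1%:R != 0 :> R by rewrite pnatr_eq0.
rewrite /geom_variance /u -/(r n) pq ppq.
have quoE x y : n.+1%:R * x / (n.+1%:R * y) = x / y :> R.
  by rewrite -mulf_div divff// mul1r.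
by rewrite !quoE !mulrA.
Unshelve. all: by end_near. Qed.

Lemma limit_std_devE : Num.sqrt (2 / ((al + be) * (2 * al + be))) =
  Num.sqrt 2 * ((al + be) * (2 * al + be)) `^ (- (1 / 2)).
Proof.
have x0 : 0 <= (al + be) * (2 * al + be).
  by rewrite mulr_ge0// addr_ge0// ?mulr_ge0// ltW.
by rewrite sqrtrM// powRN div1r powR12_sqrt// sqrtrV.
Qed.

Variables (r : R) (r01 : 0 < r < 1).

(** The variance, at time 1, of the part of the step functional that comes from
   the increments after time [x]. *)
Definition step_variance (I : nat) (x : R) :=
  inc_var I (geom_times (r `^ be) I x) (cumul_weight (r `^ al) al I).

Let r0 : 0 < r. Proof. by case/andP: r01. Qed.

Let powR_r_lt1 x : 0 < x -> r `^ x < 1.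
Proof.
case/andP: r01 => _ r1 x0; have -> : 1 = 1 `^ x :> R by rewrite powR1.
by apply: gt0_ltr_powR => //; rewrite ?nnegrE ?ltW.
Qed.

Let pq_lt1 : r `^ al * r `^ be < 1.
Proof.
rewrite -powRD; first by apply: powR_r_lt1; rewrite ltr_wpDr.
by rewrite (gt_eqF r0) implybT.
Qed.

Let ppq_lt1 : r `^ al ^+ 2 * r `^ be < 1.
Proof.
apply: le_lt_trans pq_lt1; rewrite expr2 -mulrA ler_piMl ?mulr_ge0 ?powR_ge0//.
exact/ltW/powR_r_lt1.
Qed.

Lemma step_variance_shift I x : (0 < I)%N ->
  step_variance I x = step_variance I 0 - (cumul_weight (r `^ al) al I 0) ^+ 2 * x.
Proof.
move=> I0; have al2 : al ^+ 2 != 0 by rewrite expf_neq0// gt_eqF.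
have [aln pqn ppqn] : [/\ al != 0, r `^ al * r `^ be != 1 & r `^ al ^+ 2 * r `^ be != 1].
  by rewrite (gt_eqF al0) (lt_eqF pq_lt1) (lt_eqF ppq_lt1).
apply: (mulfI al2); rewrite mulrBr /step_variance !geom_inc_var//.
rewrite /cumul_weight subn0 mulr0 subr0; congr (_ - _).
by field; rewrite gt_eqF.
Qed.

Lemma step_variance_cvg : step_variance I 0 @[I --> \oo] --> geom_variance r.
Proof.
have pq0 : 0 <= r `^ al * r `^ be by rewrite mulr_ge0 ?powR_ge0.
have ppq0 : 0 <= r `^ al ^+ 2 * r `^ be by rewrite mulr_ge0 ?exprn_ge0 ?powR_ge0.
have c1 : (r `^ al * r `^ be) ^+ I @[I --> \oo] --> 0 by apply: cvg_expr; rewrite ger0_norm.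
have c2 : (r `^ al ^+ 2 * r `^ be) ^+ I @[I --> \oo] --> 0.
  by apply: cvg_expr; rewrite ger0_norm.
set p := r `^ al in c1 c2 *; set q := r `^ be in c1 c2 *.
pose k0 := 1 - 2 * p * (1 - q) / (1 - p * q) + p ^+ 2 * (1 - q) / (1 - p ^+ 2 * q).
pose k1 := 2 * p * (1 - q) / (1 - p * q).
pose k2 := p ^+ 2 * (1 - q) / (1 - p ^+ 2 * q).
have h : (k0 + (k1 * (p * q) ^+ I - k2 * (p ^+ 2 * q) ^+ I - 2 * (p * q) ^+ I +
    (p ^+ 2 * q) ^+ I)) / al ^+ 2 @[I --> \oo] -->
    (k0 + (k1 * 0 - k2 * 0 - 2 * 0 + 0)) / al ^+ 2.
  apply: cvgM; last exact: cvg_cst.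
  apply: cvgD; first exact: cvg_cst.
  apply: cvgD => //; apply: cvgB; last by apply: cvgM => //; exact: cvg_cst.
  by apply: cvgB; apply: cvgM => //; exact: cvg_cst.
apply: (cvg_near_eq h).
  by rewrite /geom_variance -/p -/q -/k0 !mulr0 !subr0 !addr0.
near=> I.
have I0 : (0 < I)%N by near: I; exists 1%N.
have al2 : al ^+ 2 != 0 by rewrite expf_neq0// gt_eqF.
apply: (mulfI al2); rewrite mulrC divfK// /step_variance geom_inc_var//.
- by rewrite mulr0 subr0.
- by rewrite gt_eqF.
- by rewrite lt_eqF.
- by rewrite lt_eqF.
Unshelve. all: by end_near. Qed.

Lemma step_variance_gt0 I x : (0 < I)%N -> x < (r `^ be) ^+ I.-1 -> 0 < step_variance I x.
Proof.
case: I => // I _ xq; rewrite /step_variance /inc_var.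
have q1 : r `^ be <= 1.
  case/andP: r01 => _ r1; have -> : 1 = 1 `^ be :> R by rewrite powR1.
  by apply: ge0_ler_powR => //; rewrite ?nnegrE ?ltW.
have q01 : 0 < r `^ be <= 1 by rewrite q1 powR_gt0.
have g_ge0 i : 0 <= geom_times (r `^ be) I.+1 x i.+1 - geom_times (r `^ be) I.+1 x i.
  by rewrite subr_ge0; apply: (geom_times_mono q01 (ltW xq)).
rewrite big_ord_recl; apply: ltr_wpDr.
  by apply: sumr_ge0 => i _; exact: mulr_ge0 (sqr_ge0 _) (g_ge0 _).
rewrite /= subSS subn0 mulr_gt0 ?subr_gt0// exprn_gt0// /cumul_weight subn0.
by rewrite divr_gt0// subr_gt0 exprn_ilt1 ?powR_ge0// powR_r_lt1.
Qed.
End limit_variance.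

(** * Law of the iterated logarithm for the step functionals *)

Section step_functional_paths.
Context {R : realType}.
Variables (rho1 rho2 r : R).
Hypotheses (rho1_gt : -1 < rho1) (rho2_ge0 : 0 <= rho2) (r01 : 0 < r < 1).

Let al := 1 + rho1.
Let al0 : 0 < al. Proof. by rewrite /al -ltrBlDl sub0r. Qed.
Let p := r `^ al.
Let q := r `^ rho2.
Let r0 : 0 < r. Proof. by case/andP: r01. Qed.

Let p01 : 0 <= p < 1.
Proof.
rewrite powR_ge0/=; case/andP: r01 => _ r1.
have -> : 1 = 1 `^ al :> R by rewrite powR1.
by apply: gt0_ltr_powR => //; rewrite ?nnegrE ?ltW.
Qed.

Lemma ratio_powR_le1 : 0 < q <= 1.
Proof.
rewrite powR_gt0//=; case/andP: r01 => _ r1.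
have -> : 1 = 1 `^ rho2 :> R by rewrite powR1.
by apply: ge0_ler_powR => //; rewrite ?nnegrE ?ltW.
Qed.

Let qX i I : (i <= I)%N -> q ^+ I <= q ^+ i <= 1.
Proof.
case/andP: ratio_powR_le1 => q0 q1 iI.
by rewrite exprn_ile1 ?(ltW q0)// andbT; apply: ler_wiXn2l => //; exact: ltW.
Qed.

Let w := weight rho1 r.

Let w_ge0 i : 0 <= w i.
Proof.
case/andP: p01 => p0 p1; rewrite /w /weight -/al -/p divr_ge0 ?(ltW al0)//.
by rewrite subr_ge0 exprS ler_piMl ?exprn_ge0// ltW.
Qed.

Let sum_w I : \sum_(i < I) w i <= al^-1.
Proof.
case/andP: p01 => p0 p1.
have -> : \sum_(i < I) w i = (1 - p ^+ I) / al.
  elim: I => [|I IH]; first by rewrite big_ord0 expr0 subrr mul0r.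
  by rewrite big_ord_recr/= IH /w /weight -/al -/p; ring.
by rewrite ler_pdivrMr// mulVf ?gt_eqF// gerBl exprn_ge0.
Qed.

Local Notation step f := (step_functional f rho1 rho2 r).

Lemma step_functional_dist (f : R -> R) (I : nat) (s t K : R) :
  (forall i, (i < I)%N -> `|f (q ^+ i * s) - f (q ^+ i * t)| <= K) ->
  0 <= K -> `|step f I s - step f I t| <= K / al.
Proof.
move=> H K0; rewrite /step_functional -sumrB.
apply: le_trans (ler_norm_sum _ _ _) _.
apply: (@le_trans _ _ (\sum_(i < I) w i * K)).
  by apply: ler_sum => i _; rewrite -mulrBr normrM (ger0_norm (w_ge0 i)) ler_wpM2l// H.
by rewrite -mulr_suml mulrC ler_wpM2l.
Qed.

Lemma step_functional_modulus (f : R -> R) (I : nat) (e : R) : loglog_modulus f ->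
  0 < e -> exists2 dl, 0 < dl & exists T, forall s t, T <= t ->
    t <= s <= (1 + dl) * t -> `|step f I s - step f I t| <= e * phi s.
Proof.
move=> f_mod e0; have [dl dl0 [T0 H]] := f_mod (e * al) (mulr_gt0 e0 al0).
exists dl => //; exists (Num.max (expR 1) T0 / q ^+ I) => s t.
case/andP: ratio_powR_le1 => q0 q1.
rewrite ler_pdivrMr ?exprn_gt0// => Tt /andP[ts sdt].
have t0 : 0 < t.
  rewrite -(pmulr_rgt0 _ (exprn_gt0 I q0)) mulrC; apply: lt_le_trans Tt.
  by rewrite lt_max expR_gt0.
have qt i : (i <= I)%N -> Num.max (expR 1) T0 <= q ^+ i * t.
  by move=> /qX/andP[qi _]; rewrite (le_trans Tt)// mulrC ler_wpM2r// ltW.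
have -> : e * phi s = e * al * phi s / al by field; rewrite gt_eqF.
apply: step_functional_dist => [i iI|]; last by rewrite !mulr_ge0 ?phi_ge0// ltW.
have /qX/andP[_ qi1] := ltnW iI.
have := qt i (ltnW iI); rewrite ge_max => /andP[et Tqt].
have qi0 : 0 < q ^+ i by rewrite exprn_gt0.
apply: le_trans (H _ _ Tqt _) _.
  by rewrite ler_pM2l// ts/= mulrCA ler_pM2l.
rewrite ler_wpM2l ?mulr_ge0 ?(ltW e0) ?(ltW al0)//; apply: le_phi.
  by rewrite (le_trans et)// ler_pM2l.
by rewrite ler_piMl// (le_trans (ltW t0)).
Qed.

(** A lower bound at arbitrarily large real times transfers to the sequence [b],
   whose consecutive ratios tend to one. *)
Lemma step_functional_along_seq (f : R -> R) (I : nat) (b : nat -> R) (K e : R) :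
  loglog_modulus f ->
  (forall m n : nat, (0 < m)%N -> (m <= n)%N -> b m <= b n) ->
  (forall n, (0 < n)%N -> 0 < b n) ->
  b n @[n --> \oo] --> +oo -> b n.+1 / b n @[n --> \oo] --> (1 : R) ->
  (forall T, exists2 t, T <= t & K * phi t <= step f I t) -> 0 < e ->
  forall N, exists2 n, (N <= n)%N & (K - e) * phi (b n) <= `|step f I (b n)|.
Proof.
move=> f_mod b_mono b0 b_oo b_ratio HK e0 N.
have [dl dl0 [T0 HT0]] := step_functional_modulus I f_mod e0.
have [N1 _ HN1] : \forall n \near \oo, Num.max (expR 1) T0 <= b n /\ b n.+1 <= (1 + dl) * b n.
  near=> n; split; first by near: n; move/cvgryPge : b_oo; apply.
  have bn0 : 0 < b n by apply: b0; near: n; exists 1%N.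
  rewrite -ler_pdivrMr//; near: n; apply: (cvgr_le (1 : R)) => //.
  by rewrite ltrDl.
pose N2 := (maxn N N1).+1.
have [t Nt Kt] := HK (b N2).
have [j _ Hj] : \forall n \near \oo, t + 1 <= b n by move/cvgryPge : b_oo; apply.
have ex : exists n, t < b (N2 + n)%N.
  exists j; apply: (@lt_le_trans _ _ (t + 1)); first by rewrite ltrDl.
  by apply: Hj; rewrite /= leq_addl.
case: (ex_minnP ex) => -[|k] tb kmin; first by move: tb; rewrite addn0 ltNge Nt.
have bt : b (N2 + k)%N <= t.
  by rewrite leNgt; apply/negP => /kmin; rewrite ltnn.
exists (N2 + k)%N; first by rewrite /N2; lia.
have [] := HN1 (N2 + k)%N; first by rewrite /= /N2; lia.
rewrite ge_max => /andP[eb Tb] bS.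
have [Ke|Ke] := leP 0 (K - e); last first.
  by rewrite (le_trans _ (normr_ge0 _))// nmulr_rle0// phi_ge0.
have phb : phi (b (N2 + k)%N) <= phi t by exact: le_phi.
apply: (@le_trans _ _ ((K - e) * phi t)); first exact: ler_wpM2l.
have := HT0 t _ Tb; rewrite bt/= => /(_ _)/wrap[].
  by rewrite (le_trans _ bS)// -addnS ltW.
rewrite ler_norml => /andP[_ h].
by rewrite mulrBl (le_trans _ (ler_norm _))//; move: h Kt; lra.
Unshelve. all: by end_near. Qed.

End step_functional_paths.

Section step_functional_brownian.
Context {R : realType} {d : measure_display} {T : measurableType d}.
Variables (P : probability T R) (W : R -> {RV P >-> R}).
Hypothesis hW : standard_brownian_motion W.
Variables (rho1 rho2 r : R).
Hypotheses (rho1_gt : -1 < rho1) (rho2_ge0 : 0 <= rho2) (r01 : 0 < r < 1).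
Variable I : nat.
Hypothesis I0 : (0 < I)%N.

Let al := 1 + rho1.
Let al0 : 0 < al. Proof. by rewrite /al -ltrBlDl sub0r. Qed.
Let p := r `^ al.
Let q := r `^ rho2.
Let q01 : 0 < q <= 1 := ratio_powR_le1 rho2_ge0 r01.
Let cw := cumul_weight p al I.
Local Notation step w := (step_functional (W ^~ w) rho1 rho2 r I).
Local Notation V := (step_variance al rho2 r I 0).

Let p01 : 0 <= p < 1.
Proof.
rewrite powR_ge0/=; case/andP: r01 => r0 r1.
have -> : 1 = 1 `^ al :> R by rewrite powR1.
by apply: gt0_ltr_powR => //; rewrite ?nnegrE ?ltW.
Qed.

Let cw_ge0 i : 0 <= cw i.
Proof.
case/andP: p01 => p0 p1.
by rewrite divr_ge0 ?(ltW al0)// subr_ge0 exprn_ile1// ltW.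
Qed.

Let cw_le i : cw i <= al^-1.
Proof.
case/andP: p01 => p0 p1.
by rewrite ler_pdivrMr// mulVf ?gt_eqF// gerBl exprn_ge0.
Qed.

(* for [x = 0] the last term vanishes almost surely *)
Let stepE x t w : step w t = inc_sum W I (geom_times q I x) cw t w + cw 0%N * W (t * x) w.
Proof.
have /= E := weighted_sum_inc_sum p q al (fun y => W (t * y) w) I x.
rewrite /inc_sum E subrK.
by apply: eq_bigr => i _; rewrite mulrC [t * _]mulrC /weight mulrC.
Qed.

(** Along a geometric sequence of times the bound is [inc_sum_limsup_le]; between
   two such times the modulus of continuity bounds the oscillation. *)
Lemma step_functional_limsup_le : {ae P, forall w, forall e, 0 < e ->
  exists T0, forall t, T0 <= t -> `|step w t| <= (Num.sqrt (2 * V) + e) * phi t}.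
Proof.
pose c (k : nat) : R := 1 + k.+1%:R^-1.
have c1 k : 1 < c k by rewrite ltrDl invr_gt0.
have gm : {homo geom_times q I 0 : i j / (i <= j)%N >-> i <= j}.
  by apply: geom_times_mono => //; rewrite exprn_ge0//; case/andP: q01 => /ltW.
have : {ae P, forall w, forall k, \forall j \near \oo,
    `|inc_sum W I (geom_times q I 0) cw (c k ^+ j) w| <=
    (1 + k.+1%:R^-1) * Num.sqrt (2 * V) * phi (c k ^+ j)}.
  apply/ae_foralln => k.
  have g00 : 0 <= geom_times q I 0 0 by [].
  by apply: (inc_sum_limsup_le hW I cw g00 gm (c1 k)); rewrite invr_gt0.
have hmod := brownian_loglog_modulus hW.
case: (hW) => W0 _ _ _.
apply: filterS3 W0 hmod => w W0 wmod Hw e e0.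
have e20 : 0 < e / 2 by rewrite divr_gt0.
have [dl dl0 [T0 HT0]] := step_functional_modulus rho1_gt rho2_ge0 r01 I wmod e20.
have s0 : 0 <= Num.sqrt (2 * V) by exact: sqrtr_ge0.
have [k kdl ke] : exists2 k : nat, k.+1%:R^-1 <= dl & k.+1%:R^-1 * Num.sqrt (2 * V) <= e / 2.
  have [k _ Hk] : \forall k \near \oo, (k.+1%:R^-1 : R) <= Num.min dl (e / 2 / (Num.sqrt (2 * V) + 1)).
    have m0 : 0 < Num.min dl (e / 2 / (Num.sqrt (2 * V) + 1)).
      by rewrite lt_min dl0 divr_gt0// ltr_wpDl.
    by apply: (cvgr_le (0 : R)) => //; exact: cvg_harmonic.
  have := Hk k (leqnn k); rewrite /= le_min => /andP[h1 h2]; exists k => //.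
  apply: (@le_trans _ _ (k.+1%:R^-1 * (Num.sqrt (2 * V) + 1))).
    by rewrite ler_wpM2l ?lerDl// invr_ge0.
  by rewrite -ler_pdivlMr// ltr_wpDl.
have [N _ HN] := Hw k.
have [N' HN'] := geometric_ge_expR1 (c1 k).
pose N2 := maxn N N'.
have cpos j : 0 < c k ^+ j by rewrite exprn_gt0// (lt_trans _ (c1 k)).
exists (Num.max (c k * Num.max T0 1) (c k ^+ N2)) => t; rewrite ge_max => /andP[T0t N2t].
have t1 : 1 <= t by rewrite (le_trans _ N2t)// exprn_ege1// ltW.
have [j /andP[jt tj]] := geometric_bracket (c1 k) t1.
have : (N2 <= j)%N by have := le_lt_trans N2t tj; rewrite ltr_eXn2l.
rewrite geq_max => /andP[Nj N'j].
have ej : expR 1 <= c k ^+ j by apply: le_trans HN' _; rewrite ler_eXn2l.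
have T0j : T0 <= c k ^+ j.
  apply: (@le_trans _ _ (Num.max T0 1)); first by rewrite le_max lexx.
  have := le_trans T0t (ltW tj); rewrite exprS ler_pM2l//.
  exact: lt_trans (c1 k).
have hZ : `|step w (c k ^+ j)| <= (1 + k.+1%:R^-1) * Num.sqrt (2 * V) * phi (c k ^+ j).
  by rewrite (stepE 0) mulr0 W0 mulr0 addr0; exact: HN.
have hD := HT0 t _ T0j; rewrite jt/= in hD.
have {}hD : `|step w t - step w (c k ^+ j)| <= e / 2 * phi t.
  apply: hD; rewrite (le_trans (ltW tj))// exprS ler_wpM2r ?(ltW (cpos j))//.
  by rewrite lerD2l.
have phj : phi (c k ^+ j) <= phi t by exact: le_phi.
have -> : step w t = (step w t - step w (c k ^+ j)) + step w (c k ^+ j) by ring.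
apply: le_trans (ler_normD _ _) _; apply: le_trans (lerD hD hZ) _.
have ph0 := phi_ge0 t.
have h1 : (1 + k.+1%:R^-1) * Num.sqrt (2 * V) * phi (c k ^+ j) <=
    (Num.sqrt (2 * V) + e / 2) * phi t.
  apply: ler_pM => //; first exact: phi_ge0.
  by rewrite mulrDl mul1r lerD2l.
apply: le_trans (lerD (lexx _) h1) _; rewrite -mulrDl le_eqVlt; apply/orP; left.
by apply/eqP; congr (_ * _); field.
Qed.

(** For a large ratio [c], the part of the functional that depends on the path
   before [t / c] is negligible, both in variance and, by [loglog_bounded], in
   size; the rest depends on independent blocks of increments. *)
Lemma step_functional_limsup_ge : {ae P, forall w, forall e, 0 < e ->
  forall T0, exists2 t, T0 <= t & (Num.sqrt (2 * V) - e) * phi t <= step w t}.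
Proof.
pose c (k : nat) : R := k.+2%:R.
have c1 k : 1 < c k by rewrite ltr1n.
have c0 k : 0 < c k by rewrite ltr0n.
pose Vc k := step_variance al rho2 r I (c k)^-1.
have aeH : {ae P, forall w, forall k, (c k)^-1 < q ^+ I.-1 ->
    forall m, exists2 j, (m <= j)%N & (1 - (c k)^-1) * Num.sqrt (2 * Vc k) *
      phi (c k ^+ j.+1) <= inc_sum W I (geom_times q I (c k)^-1) cw (c k ^+ j.+1) w}.
  apply/ae_foralln => k.
  have [ck|nck] := boolP ((c k)^-1 < q ^+ I.-1); last exact/aeW.
  have gm := geom_times_mono q01 (ltW ck).
  have V0 : 0 < Vc k by exact: step_variance_gt0.
  have e01 : 0 < (c k)^-1 < 1 by rewrite invr_gt0 c0/= invf_lt1.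
  have := inc_sum_limsup_ge hW I0 (c1 k) (erefl : geom_times q I (c k)^-1 0 = (c k)^-1)
    (geom_times_last q _ I0) gm cw_ge0 V0 e01.
  by apply: filterS => w Hw _.
have hbnd := brownian_loglog_bounded hW.
apply: filterS2 hbnd aeH => w [Tb Hb] Hw e e0 T0.
have [k [kq kV]] : exists k, (c k)^-1 < q ^+ I.-1 /\
    Num.sqrt (2 * V) - e <= (1 - (c k)^-1) * Num.sqrt (2 * Vc k) -
      20 / al * Num.sqrt (c k)^-1.
  have ci : (c k)^-1 @[k --> \oo] --> (0 : R).
    by rewrite (cvg_shiftS (fun k => k.+1%:R^-1 : R^o)); exact: cvg_harmonic.
  have Vci : Vc k @[k --> \oo] --> V.
    have h : V - cw 0%N ^+ 2 * (c k)^-1 @[k --> \oo] --> V - cw 0%N ^+ 2 * 0.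
      apply: cvgB; first exact: cvg_cst.
      by apply: cvgM => //; exact: cvg_cst.
    apply: (cvg_near_eq h); first by rewrite mulr0 subr0.
    by apply: nearW => k; rewrite /Vc [RHS]step_variance_shift.
  have h : (1 - (c k)^-1) * Num.sqrt (2 * Vc k) - 20 / al * Num.sqrt (c k)^-1
      @[k --> \oo] --> (1 - 0) * Num.sqrt (2 * V) - 20 / al * Num.sqrt 0.
    apply: cvgB; apply: cvgM.
    - by apply: cvgB => //; exact: cvg_cst.
    - apply: (cvg_comp (fun k => 2 * Vc k)); last exact: sqrt_continuous.
      by apply: cvgM => //; exact: cvg_cst.
    - exact: cvg_cst.
    - apply: (cvg_comp (fun k => (c k)^-1)); last exact: sqrt_continuous.
      exact: ci.
  have [k _ Hk] : \forall k \near \oo, (c k)^-1 < q ^+ I.-1 /\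
    Num.sqrt (2 * V) - e <= (1 - (c k)^-1) * Num.sqrt (2 * Vc k) -
      20 / al * Num.sqrt (c k)^-1.
    near=> k; split.
      near: k; apply: (cvgr_lt (0 : R)) => //.
      by rewrite exprn_gt0//; case/andP: q01.
    near: k; apply: (cvgr_ge _ h).
    by rewrite subr0 mul1r sqrtr0 mulr0 subr0 gtrBl.
  by exists k; apply: Hk; exact: leqnn.
have [N HN] := geometric_ge_expR1 (c1 k).
have [N' HN'] : exists N', Num.max T0 Tb <= c k ^+ N'.
  have m1 : 1 <= Num.max 1 (Num.max T0 Tb) by rewrite le_max lexx.
  have [N' /andP[_ /ltW h]] := geometric_bracket (c1 k) m1.
  by exists N'.+1; apply: le_trans h; rewrite le_max lexx orbT.
have [j mj Hj] := Hw k kq (maxn N N').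
move: mj; rewrite geq_max => /andP[Nj N'j].
have ekj : expR 1 <= c k ^+ j by rewrite (le_trans HN)// ler_eXn2l.
have : Num.max T0 Tb <= c k ^+ j by rewrite (le_trans HN')// ler_eXn2l.
rewrite ge_max => /andP[T0j Tbj].
have cj : c k ^+ j <= c k ^+ j.+1 by rewrite ler_eXn2l.
exists (c k ^+ j.+1); first exact: le_trans cj.
set t := c k ^+ j.+1.
have tc : t * (c k)^-1 = c k ^+ j by rewrite /t exprSr mulfK// gt_eqF.
rewrite (stepE (c k)^-1) tc.
have hb := Hb _ Tbj.
have phj : phi (c k ^+ j) <= Num.sqrt (c k)^-1 * phi t.
  rewrite /phi -sqrtrM ?invr_ge0 ?(ltW (c0 k))//; apply: ler_wsqrtr.
  rewrite mulrA [_^-1 * t]mulrC tc ler_wpM2l ?exprn_ge0 ?(ltW (c0 k))//.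
  exact: le_lnln.
have hb2 : - (20 / al * Num.sqrt (c k)^-1 * phi t) <= cw 0%N * W (c k ^+ j) w.
  rewrite lerNl -mulrN; apply: le_trans (ler_norm _) _.
  rewrite normrM normrN (ger0_norm (cw_ge0 0)).
  have -> : 20 / al * Num.sqrt (c k)^-1 * phi t =
    al^-1 * (20 * (Num.sqrt (c k)^-1 * phi t)) by ring.
  apply: ler_pM => //; apply: (le_trans hb); by rewrite ler_pM2l.
apply: le_trans (lerD Hj hb2); rewrite -mulrBl ler_wpM2r//; exact: phi_ge0.
Unshelve. all: by end_near. Qed.

End step_functional_brownian.

(** * The limit superior of the means *)

Section choice_of_partition.
Context {R : realType}.
Variables (rho1 rho2 : R).
Hypotheses (rho1_gt : -1 < rho1) (rho2_ge0 : 0 <= rho2).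

Definition partition_ratio (m : nat) : R := m.+1%:R / m.+2%:R.

Lemma partition_ratio01 m : 0 < partition_ratio m < 1.
Proof. by rewrite divr_gt0//= ltr_pdivrMr// mul1r ltr_nat. Qed.

Definition limit_std_dev : R :=
  Num.sqrt (2 / ((1 + rho1 + rho2) * (2 * (1 + rho1) + rho2))).

(** The limits are iterated: the number of points of the partition tends to
   infinity first, and its ratio tends to one afterwards. *)
Lemma partition_choice (e dl : R) : 0 < e -> 0 < dl ->
  exists m, 1 < (1 + dl) * partition_ratio m `^ rho2 /\ \forall I \near \oo,
    `|Num.sqrt (step_variance (1 + rho1) rho2 (partition_ratio m) I 0) - limit_std_dev| <= e.
Proof.
move=> e0 dl0; have e20 : 0 < e / 2 by rewrite divr_gt0.
have al0 : 0 < 1 + rho1 by rewrite -ltrBlDl sub0r.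
have gv := geom_variance_cvg al0 rho2_ge0.
have sgv : Num.sqrt (geom_variance (1 + rho1) rho2 (n%:R / n.+1%:R)) @[n --> \oo] -->
    limit_std_dev.
  by apply: (cvg_comp (fun n => geom_variance (1 + rho1) rho2 (n%:R / n.+1%:R)));
    [exact: gv|exact: sqrt_continuous].
move/cvgrPdist_le : sgv => /(_ _ e20) sgv.
have [[|m] _ Hm] : \forall n \near \oo, (0 < n)%N /\
    1 < (1 + dl) * (n%:R / n.+1%:R) `^ rho2 /\
    `|limit_std_dev - Num.sqrt (geom_variance (1 + rho1) rho2 (n%:R / n.+1%:R))| <= e / 2.
  near=> n; split; first by near: n; exists 1%N.
  split; last by near: n.
  rewrite -ltr_pdivrMl ?addr_gt0// mulr1.
  near: n; apply: (cvgr_gt (1 : R)) (ratio_powR_cvg rho2) _ _.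
  by rewrite invf_lt1 ?ltrDl// addr_gt0.
- by have [] := Hm 0%N (leqnn _).
have [_ [h1 h2]] := Hm m.+1 (leqnn _); exists m; split => //.
have sv : Num.sqrt (step_variance (1 + rho1) rho2 (partition_ratio m) I 0) @[I --> \oo] -->
    Num.sqrt (geom_variance (1 + rho1) rho2 (partition_ratio m)).
  apply: (cvg_comp (fun I => step_variance (1 + rho1) rho2 (partition_ratio m) I 0)).
    exact: (step_variance_cvg al0 rho2_ge0 (partition_ratio01 m)).
  exact: sqrt_continuous.
move/cvgrPdist_le : sv => /(_ _ e20) sv.
near=> I.
have : `|Num.sqrt (geom_variance (1 + rho1) rho2 (partition_ratio m)) -
    Num.sqrt (step_variance (1 + rho1) rho2 (partition_ratio m) I 0)| <= e / 2.
  by near: I.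
rewrite distrC => h3; rewrite -/(partition_ratio m) distrC in h2.
apply: le_trans (ler_distD (Num.sqrt (geom_variance (1 + rho1) rho2 (partition_ratio m))) _ _) _.
by rewrite [leRHS]splitr; exact: lerD.
Unshelve. all: by end_near. Qed.

End choice_of_partition.

Theorem theorem1p2 (R : realType) (d : measure_display) (T : measurableType d)
    (P : probability T R)
    (M : nat -> {RV P >-> R}) (W : R -> {RV P >-> R})
    (a b : nat -> R) (rho1 rho2 : R)
    (hW : standard_brownian_motion W)
    (ha : positive_seq a) (hb : positive_seq b)
    (hb_mono : forall m n : nat, (0 < m)%N -> (m <= n)%N -> b m <= b n)
    (hb_lim : b n @[n --> \oo] --> +oo)
    (hb_ratio : b n.+1 / b n @[n --> \oo] --> (1 : R))
    (hM : {ae P, forall w : T,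
       (fun n : nat => M n w / a n - W (b n) w) =o_\oo
       (fun n : nat => Num.sqrt (b n * ln (ln (b n))))})
    (hrho1 : -1 < rho1) (hrho2 : 0 <= rho2)
    (ha_rv : regularly_varying a rho1) (hb_rv : regularly_varying b rho2) :
  {ae P, forall w : T,
     limn_esup (fun n : nat =>
       ((Num.sqrt (2 * a n ^+ 2 * b n * ln (ln (b n))))^-1 *
        `| n%:R^-1 * \sum_(1 <= k < n.+1) M k w |)%:E) =
     (Num.sqrt 2 *
      ((1 + rho1 + rho2) * (2 + 2 * rho1 + rho2)) `^ (- (1 / 2)))%:E}.
Proof.
have al0 : 0 < 1 + rho1 by rewrite -ltrBlDl sub0r.
have -> : Num.sqrt 2 * ((1 + rho1 + rho2) * (2 + 2 * rho1 + rho2)) `^ (- (1 / 2)) =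
    limit_std_dev rho1 rho2.
  rewrite /limit_std_dev (limit_std_devE al0 hrho2).
  by congr (_ * (_ * (_ + _)) `^ _); ring.
set sd := limit_std_dev rho1 rho2.
have hle : {ae P, forall w, forall m I, forall e, 0 < e -> exists T0, forall t, T0 <= t ->
    `|step_functional (W ^~ w) rho1 rho2 (partition_ratio m) I.+1 t| <=
    (Num.sqrt (2 * step_variance (1 + rho1) rho2 (partition_ratio m) I.+1 0) + e) * phi t}.
  apply/ae_foralln => m; apply/ae_foralln => I.
  exact: (step_functional_limsup_le hW hrho1 hrho2 (partition_ratio01 m) I.+1).
have hge : {ae P, forall w, forall m I, forall e, 0 < e -> forall T0, exists2 t, T0 <= t &
    (Num.sqrt (2 * step_variance (1 + rho1) rho2 (partition_ratio m) I.+1 0) - e) * phi t <=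
    step_functional (W ^~ w) rho1 rho2 (partition_ratio m) I.+1 t}.
  apply/ae_foralln => m; apply/ae_foralln => I.
  exact: (step_functional_limsup_ge hW hrho1 hrho2 (partition_ratio01 m) (ltn0Sn I)).
have hpath : {ae P, forall w, loglog_bounded (W ^~ w) /\ loglog_modulus (W ^~ w)}.
  exact: filterI (brownian_loglog_bounded hW) (brownian_loglog_modulus hW).
apply: filterS3 hpath hM (filterI hle hge) => w [fb fm] wM [{}hle {}hge].
pose f := W ^~ w; pose mk k := M k w.
have b0 n : (0 < n)%N -> 0 < b n by exact: hb.
have phiy : phi (b n) @[n --> \oo] --> +oo by exact: cvg_comp hb_lim (@phi_cvg R).
have m_approx e : 0 < e -> \forall n \near \oo, `|mk n / a n - f (b n)| <= e * phi (b n).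
  move=> e0; move/eqoP : wM => /(_ e e0); apply: filterS => n.
  by rewrite [X in _ <= _ * X -> _]ger0_norm// sqrtr_ge0.
have s21 : 1 <= Num.sqrt 2 :> R by rewrite -[leLHS]sqrtr1; apply: ler_wsqrtr; rewrite ler1n.
have s20 : 0 < Num.sqrt 2 :> R by exact: lt_le_trans s21.
have uE : \forall n \near \oo, 0 < phi (b n) /\
    (Num.sqrt (2 * a n ^+ 2 * b n * ln (ln (b n))))^-1 *
    `| n%:R^-1 * \sum_(1 <= k < n.+1) M k w | = `|scaled_mean a mk n| / (Num.sqrt 2 * phi (b n)).
  near=> n.
  have n0 : (0 < n)%N by near: n; exists 1%N.
  have ph0 : 0 < phi (b n).
    by apply: lt_le_trans ltr01 _; near: n; move/cvgryPge : phiy => /(_ 1).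
  split => //; have an := ha n n0.
  have -> : 2 * a n ^+ 2 * b n * ln (ln (b n)) = 2 * (a n ^+ 2 * (b n * ln (ln (b n)))).
    by ring.
  rewrite sqrtrM// sqrtrM ?sqr_ge0// sqrtr_sqr (gtr0_norm an) -/(phi (b n)).
  rewrite /scaled_mean !normrM !normfV normrM normr_nat (gtr0_norm an) /mk.
  by field; rewrite !gt_eqF//= ltr0n.
have approx e : 0 < e -> exists m I,
    `|Num.sqrt (step_variance (1 + rho1) rho2 (partition_ratio m) I.+1 0) - sd| <= e /\
    \forall n \near \oo, `|scaled_mean a mk n -
      step_functional f rho1 rho2 (partition_ratio m) I.+1 (b n)| <= e * phi (b n).
  move=> e0; pose C := 4 / (1 + rho1) + 4.
  have C0 : 0 < C by rewrite addr_gt0// divr_gt0.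
  have eC : 0 < e / C by rewrite divr_gt0.
  have [dl dl0 Hdl] := fm _ eC.
  have [m [hm [I1 _ HI1]]] := partition_choice hrho1 hrho2 e0 dl0.
  have [I0 HI0] := scaled_mean_step_functional ha_rv hb_rv hb_mono hb_lim hrho1 hrho2
    fb m_approx (partition_ratio01 m) eC dl0 Hdl hm.
  exists m, (maxn I0 I1); split.
    by apply: HI1; rewrite /= leqW// leq_maxr.
  have := HI0 (maxn I0 I1).+1 (leqW (leq_maxl _ _)); apply: filterS => n.
  by rewrite -/C [C * _]mulrC divfK// gt_eqF.
apply: limn_esup_EFin => e e0.
- have e4 : 0 < e / 4 by rewrite divr_gt0.
  have [m [I [hs hX]]] := approx _ e4.
  have [T0 HT0] := hle m I _ e4.
  near=> n.
  have [ph0 ->] : 0 < phi (b n) /\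
    (Num.sqrt (2 * a n ^+ 2 * b n * ln (ln (b n))))^-1 *
    `| n%:R^-1 * \sum_(1 <= k < n.+1) M k w | = `|scaled_mean a mk n| / (Num.sqrt 2 * phi (b n)).
    by near: n.
  have hXn : `|scaled_mean a mk n - step_functional f rho1 rho2 (partition_ratio m) I.+1 (b n)| <=
      e / 4 * phi (b n) by near: n.
  have hZ := HT0 (b n).
  have {}hZ : `|step_functional f rho1 rho2 (partition_ratio m) I.+1 (b n)| <=
      (Num.sqrt (2 * step_variance (1 + rho1) rho2 (partition_ratio m) I.+1 0) + e / 4) * phi (b n).
    by apply: hZ; near: n; move/cvgryPge : hb_lim; apply.
  rewrite ler_pdivrMr ?mulr_gt0//.
  move: hs hXn hZ; rewrite sqrtrM//.
  set sV := Num.sqrt (step_variance _ _ _ _ _); set Z := step_functional _ _ _ _ _ _.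
  rewrite ler_norml => /andP[_ hs] hXn hZ.
  have := ler_normD (scaled_mean a mk n - Z) Z; rewrite subrK.
  move=> /le_trans; apply; apply: le_trans (lerD hXn hZ) _.
  rewrite -mulrDl mulrA ler_pM2r//.
  by nra.
- move=> N.
  have e4 : 0 < e / 4 by rewrite divr_gt0.
  have [m [I [hs hX]]] := approx _ e4.
  have [N1 _ HN1] := filterI uE hX.
  have [n Nn hZ] := step_functional_along_seq hrho1 hrho2 (partition_ratio01 m) fm hb_mono b0
    hb_lim hb_ratio (hge m I _ e4) e4 (maxn N N1).
  move: Nn; rewrite geq_max => /andP[Nn N1n]; exists n => //.
  have [[ph0 ->] hXn] := HN1 n N1n.
  rewrite ler_pdivlMr ?mulr_gt0//.
  move: hs hXn hZ; rewrite sqrtrM//.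
  set sV := Num.sqrt (step_variance _ _ _ _ _); set Z := step_functional _ _ _ _ _ _.
  rewrite ler_norml => /andP[hs _] hXn hZ.
  have := ler_normD (Z - scaled_mean a mk n) (scaled_mean a mk n); rewrite subrK distrC => h.
  have {}h := le_trans hZ (le_trans h (lerD hXn (lexx _))).
  rewrite -lerBlDl -mulrBl in h.
  apply: le_trans h; rewrite mulrA ler_pM2r//.
  by nra.
Unshelve. all: by end_near. Qed.
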